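(* Let $h$ be a positive integer and put $p'=2h-1$. If $p,q,r$ are odd primes satisfying the congruences $$q\equiv 2\pmod{p'},\qquad r\equiv\frac{p'q+1}{2}\pmod{p'q},\qquad p\equiv p'\pmod{qr},$$ then $$A(pqr)=h\quad\text{or}\quad A(pqr)=h+1.$$
   Context: For a positive integer $n$, let $\Phi_n(x)=\sum_{0\le m\le\varphi(n)}a_m(n)x^m$ be the $n$th cyclotomic polynomial, where $\varphi$ is Euler's totient function. The height of $\Phi_n$ is $A(n)=\max_m|a_m(n)|$. The integer $p'=2h-1$ is not assumed to be prime; when $h=1$ we have $p'=1$ and a congruence modulo $1$ is vacuous. *)

(* Defs.v *)
From mathcomp Require Import all_boot all_order all_algebra all_field.
Set Implicit Arguments.
Unset Strict Implicit.
Unset Printing Implicit Defensive.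
Import GRing.Theory.

Local Open Scope nat_scope.

Definition cyclotomic_height (n : nat) : nat :=
  \max_(m < (totient n).+1) `|(('Phi_n)`_m)%R|.

(* Main.v *)
(** Put s = p' = 2h - 1, q = ts + 2, 2r = 1 + usq and p = s + kqr.  From
    Phi_pqr(x) (1 - x^qr) = Phi_qr(x^p) (1 + x + ... + x^(q-1)) (1 - x^r) and
    Phi_qr(x) (1 - x^qr) = (1 - x) sum_(a < r, b < q) x^(aq + br),
    Abel summation expresses the n-th coefficient of Phi_pqr, up to a boundary
    term in {-1, 0, 1}, as a mixed second difference
    T(x, y) - T(x', y) - T(x, y') + T(x', y'), where T(x, y) counts the i < s
    with ((x + ui) mod r) q + ((y + ti) mod q) r <= M, M = n %/ p, x' = x + uq
    and y' = y + th + 1.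

    Since ts = -2 mod q, the points counted by T(x, y') can be matched with
    those counted by T(x, y) so that matched values differ by a small positive
    number plus qr times a winding number in {-1, 0, 1}.  The values along a
    line are too far apart for M to separate two close pairs, so
    T(x, y) - T(x, y') is governed by the number of pairs which wind, and this
    number is at most about h.  Hence the second difference is at most h in
    absolute value and all coefficients are at most h + 1.  Explicit n give a
    second difference of absolute value h with zero boundary term. *)
Require Import Defs.
From mathcomp Require Import all_boot all_order all_algebra all_field.
From mathcomp Require Import zify ring.
Set Implicit Arguments.
Unset Strict Implicit.
Unset Printing Implicit Defensive.
Import Order.TTheory GRing.Theory Num.Theory.
Local Open Scope ring_scope.

(** * Sums of integer-valued indicators *)

Definition ind (b : bool) : int := (b : nat)%:Z.

Lemma sum_ind_le1 (n : nat) (c : nat -> bool) :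
  (forall i j, (i < j < n)%N -> c i -> c j -> False) ->
  \sum_(0 <= i < n) ind (c i) <= 1.
Proof.
elim: n => [|n IHn] cP; first by rewrite big_geq.
rewrite big_nat_recr //=; case cn: (c n); last first.
  by rewrite addr0; apply: IHn => i j ij; apply: cP; lia.
rewrite big_nat_cond big1 // => i /andP[/andP[_ i_lt] _].
by case ci: (c i) => //; case: (cP i n) => //; lia.
Qed.

Lemma sum_ind_interval (n a b : nat) : (a <= b <= n)%N ->
  \sum_(0 <= i < n) ind (a <= i < b)%N = (b - a)%:Z.
Proof.
elim: n b => [|n IHn] b abn; first by rewrite big_geq; lia.
rewrite big_nat_recr //=; case: (ltnP n b) => [nb|bn].
  have -> : b = n.+1 by lia.
  rewrite (eq_big_nat _ _ (F2 := fun i => ind (a <= i < n)%N)); last first.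
    by move=> i i_lt; congr ind; lia.
  case: (leqP a n) => an; first by rewrite IHn /ind; lia.
  by rewrite big_nat_cond big1 => [|i]; rewrite /ind; lia.
by rewrite IHn /ind; lia.
Qed.

Lemma sum_ind_eq (n k : nat) (F : nat -> int) :
  \sum_(0 <= i < n) ind (i == k) * F i = if (k < n)%N then F k else 0.
Proof.
elim: n => [|n IHn]; first by rewrite big_geq.
rewrite big_nat_recr //= IHn [in RHS]ltnS [in RHS]leq_eqVlt (eq_sym k).
case: (eqVneq n k) => [->|_] /=; first by rewrite ltnn mul1r add0r.
by rewrite mul0r addr0.
Qed.


(** * Comparison of matched values *)

Section Comparison.

Variables (n : nat) (v v' k w : nat -> int) (M Q : int).
Hypotheses (v'E : forall i, (i < n)%N -> v' i = v i - k i + Q * w i)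
  (kQ : forall i, (i < n)%N -> 0 <= k i <= Q)
  (w1 : forall i, (i < n)%N -> -1 <= w i <= 1).

Let e i := ind (v i <= M) - ind (v' i <= M).
Let crossing i := (w i == 0) && (v i - k i <= M < v i).

(** Only [w i = 1] permits [v i <= M < v' i]: otherwise [0 <= k i <= Q] gives [v' i <= v i]. *)
Lemma comparison_ub :
  \sum_(0 <= i < n) e i <= \sum_(0 <= i < n) ind (w i == 1).
Proof.
apply: ler_sum_nat => i /andP[_ i_lt]; rewrite /e v'E //.
move: (kQ i_lt) (w1 i_lt).
have [->|] : w i = 0 \/ w i = 1 \/ w i = -1 by have := w1 i_lt; lia.
  by rewrite /ind; lia.
by case=> ->; rewrite /ind; lia.
Qed.

(** A contribution -1 means [v' i <= M < v i], which [k i <= Q] excludes for [w i = 1] and which is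
    a crossing of [M] for [w i = 0]. *)
Lemma comparison_lb_crossing :
  - \sum_(0 <= i < n) ind (w i == -1) - \sum_(0 <= i < n) ind (crossing i)
  <= \sum_(0 <= i < n) e i.
Proof.
rewrite -opprD -big_split /= -sumrN.
apply: ler_sum_nat => i /andP[_ i_lt]; rewrite /e /crossing v'E //.
move: (kQ i_lt) (w1 i_lt).
have [->|] : w i = 0 \/ w i = 1 \/ w i = -1 by have := w1 i_lt; lia.
  by rewrite /ind; lia.
by case=> ->; rewrite /ind; lia.
Qed.

Lemma comparison_lb_no_crossing :
  (forall i, (i < n)%N -> w i = 0 -> v i - k i <= M < v i -> False) ->
  - \sum_(0 <= i < n) ind (w i == -1) <= \sum_(0 <= i < n) e i.
Proof.
move=> ncr; have cr0 : \sum_(0 <= i < n) ind (crossing i) = 0.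
  rewrite big_nat_cond big1 // => i /andP[/andP[_ i_lt] _]; rewrite /crossing /ind.
  by case: eqP => //= wi; case: (boolP (_ <= _ < _)) => // /(ncr i i_lt wi).
by have := comparison_lb_crossing; rewrite cr0 subr0.
Qed.

Lemma comparison_lb :
  (forall i j, (i < j < n)%N -> v i - k i <= M < v i ->
     v j - k j <= M < v j -> False) ->
  - \sum_(0 <= i < n) ind (w i == -1) - 1 <= \sum_(0 <= i < n) e i.
Proof.
move=> cr1; apply: le_trans comparison_lb_crossing; rewrite lerD2l lerN2.
apply: sum_ind_le1 => i j ij /andP[_ ci] /andP[_ cj]; exact: cr1 ij ci cj.
Qed.

End Comparison.

Lemma divz_lt2 (m x : int) : 0 <= x < 2 * m -> (x %/ m)%Z = ind (m <= x).
Proof.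
move=> x_bnd; rewrite /ind; case: (lerP m x) => mx.
  have -> : x = 1 * m + (x - m) by ring.
  by rewrite divzMDl ?divz_small; lia.
by rewrite divz_small //; lia.
Qed.

Lemma divzN1 (m : int) : 0 < m -> (-1 %/ m)%Z = -1.
Proof.
move=> m0; have -> : -1 = -1 * m + (m - 1) by ring.
by rewrite divzMDl ?divz_small; lia.
Qed.

Lemma sum_eq_pointwise (n : nat) (f g : nat -> int) :
  (forall i, (i < n)%N -> f i <= g i) ->
  \sum_(0 <= i < n) g i <= \sum_(0 <= i < n) f i ->
  forall i, (i < n)%N -> f i = g i.
Proof.
elim: n => // n IHn fg; rewrite !big_nat_recr //= => gf.
have fg' : \sum_(0 <= i < n) f i <= \sum_(0 <= i < n) g i.
  by apply: ler_sum_nat => i i_lt; apply: fg; lia.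
have fgn := fg n (leqnn _).
have {}gf : \sum_(0 <= i < n) g i + g n <= \sum_(0 <= i < n) f i + f n by [].
move=> i; rewrite ltnS leq_eqVlt => /orP[/eqP->|i_lt]; first by lia.
by apply: IHn => //; [move=> j j_lt; apply: fg; lia | lia].
Qed.

(** Deliberately not reduced modulo [q * r]: the value is an exponent of [lattice_poly], to be
    compared with a cutoff. *)
Definition residue_value (q r x y : int) : int :=
  (x %% r)%Z * q + (y %% q)%Z * r.

Lemma residue_valueE (q r x y : int) :
  residue_value q r x y = x * q + y * r - r * q * ((x %/ r)%Z + (y %/ q)%Z).
Proof. by rewrite /residue_value /modz; ring. Qed.

(** * The second difference of lattice counts *)

Definition lattice_count (s : nat) (t u q r M x y : int) : int :=
  \sum_(0 <= i < s) ind (residue_value q r (x + u * i%:Z) (y + t * i%:Z) <= M).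

Lemma eq_lattice_count (s : nat) (t u q r M x x' y y' : int) :
  (x = x' %[mod r])%Z -> (y = y' %[mod q])%Z ->
  lattice_count s t u q r M x y = lattice_count s t u q r M x' y'.
Proof.
move=> xx yy; apply: eq_bigr => i _; rewrite /residue_value.
by rewrite -(modzDml x) xx modzDml -(modzDml y) yy modzDml.
Qed.

Section UpperBound.

Variables (h s : nat) (t u q r : int).
Hypotheses (h_gt1 : (1 < h)%N) (sE : s = (2 * h - 1)%N) (t_gt0 : 0 < t)
  (u_gt0 : 0 < u) (qE : q = t * s%:Z + 2) (rE : 2 * r = 1 + u * s%:Z * q).

Local Notation L := (residue_value q r).

(* d is the increment of the value from one index to the next. *)
Let d := u * q + t * r.

Let sZ : s%:Z = 2 * h%:Z - 1. Proof. lia. Qed.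
Let q_ge : s%:Z + 2 <= q.
Proof. by have : s%:Z <= t * s%:Z; [apply: ler_peMl; lia | lia]. Qed.
Let suq : s%:Z * (u * q) = 2 * r - 1. Proof. lia. Qed.
(** Thus [d] is minus the inverse of [s] modulo [r * q], and [s] steps of a line nearly close up. *)
Let sd : s%:Z * d = r * q - 1.
Proof.
have -> : s%:Z * d = s%:Z * (u * q) + (t * s%:Z) * r by rewrite /d; ring.
by rewrite suq; rewrite [in RHS]qE; ring.
Qed.
Let uqq : u * q * q = 2 * d - t.
Proof.
have : u * q * q = 2 * (u * q) + t * (s%:Z * (u * q)) by rewrite [X in _ * X = _]qE; ring.
rewrite suq /d; lia.
Qed.
Let uq_ge : q <= u * q. Proof. by apply: ler_peMl; lia. Qed.
Let r_gt : u * q < r.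
Proof.
by have : 3 * (u * q) <= s%:Z * (u * q); [apply: ler_wpM2r; lia | lia].
Qed.

(* The amount by which a value exceeds its matched value when neither winds. *)
Let k (i : nat) : int := if (h <= i)%N then u * h%:Z * q - r else r - u * (h%:Z - 1) * q.

(** Both gaps are close to [r / s], about half of [u * q]; multiplying by [s] clears the
    fractions. *)
Let kE i : (s%:Z * k i = r - h%:Z) \/ (s%:Z * k i = r + h%:Z - 1).
Proof.
rewrite /k; case: (leqP h i) => _; [left|right].
  have -> : s%:Z * (u * h%:Z * q - r) = h%:Z * (s%:Z * (u * q)) - s%:Z * r by ring.
  by rewrite suq sZ; ring.
have -> : s%:Z * (r - u * (h%:Z - 1) * q) = s%:Z * r - (h%:Z - 1) * (s%:Z * (u * q)) by ring.
by rewrite suq sZ; ring.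
Qed.

Let h_lt_uq : h%:Z < u * q. Proof. lia. Qed.

Let k_bnd i : 0 < k i < u * q.
Proof.
have s_gt0 : 0 < s%:Z by lia.
rewrite -(ltr_pM2l s_gt0 0) mulr0 -(ltr_pM2l s_gt0 (k i)) suq.
by have := kE i; lia.
Qed.

Let k_lt_d i : k i < d - t.
Proof.
have := k_bnd i; have : t <= t * r by apply: ler_peMr; lia.
by rewrite /d; lia.
Qed.

Let d_gt : u * q + t < d.
Proof.
by have : t * 2 <= t * r; [apply: ler_wpM2l; lia | rewrite /d; lia].
Qed.
Let d_lt : 2 * d < r * q.
Proof. by have : 2 * d <= s%:Z * d; [apply: ler_wpM2r; lia | lia]. Qed.

(* X + ui passes the modulus r at index a; a = s means that it never does. *)
Definition wrap_at (X : int) (a : nat) :=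
  (0 < a <= s)%N /\ forall i, (i < s)%N -> (r <= X + u * i%:Z) = (a <= i)%N.

Lemma wrap_at_none X : 0 <= X -> X + u * (s%:Z - 1) < r -> wrap_at X s.
Proof.
move=> X0 X_lt; split=> [|i i_lt]; first lia.
have ui : u * i%:Z <= u * (s%:Z - 1) by apply: ler_wpM2l; lia.
by lia.
Qed.

(** The coordinates rise by at most [u * (s - 1) < r] and [t * (s - 1) < q] along a line, so each is
    reduced at most once. *)
Lemma residue_value_line X Y a i :
  0 <= X < r -> 0 <= Y < q -> wrap_at X a -> (i < s)%N ->
  L (X + u * i%:Z) (Y + t * i%:Z) = X * q + Y * r + i%:Z * d
          - r * q * (ind (a <= i)%N + ind (q <= Y + t * i%:Z)).
Proof.
move=> X_bnd Y_bnd [a_bnd aP] i_lt.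
have us : u * (s%:Z - 1) < r.
  by have : u * s%:Z * 2 <= u * s%:Z * q; [apply: ler_wpM2l; lia | lia].
have ti0 : 0 <= t * i%:Z by apply: mulr_ge0; lia.
have ti : t * i%:Z <= t * (s%:Z - 1) by apply: ler_wpM2l; lia.
have ui0 : 0 <= u * i%:Z by apply: mulr_ge0; lia.
have ui : u * i%:Z <= u * (s%:Z - 1) by apply: ler_wpM2l; lia.
rewrite residue_valueE.
rewrite (@divz_lt2 r (X + u * i%:Z)) ?(@divz_lt2 q (Y + t * i%:Z)) ?aP //; lia.
Qed.

Lemma lattice_count_line X Y M a (m : nat -> bool) :
  0 <= X < r -> 0 <= Y < q -> wrap_at X a ->
  (forall i, (i < s)%N -> (X * q + Y * r + i%:Z * d
     - r * q * (ind (a <= i)%N + ind (q <= Y + t * i%:Z)) <= M) = m i) ->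
  lattice_count s t u q r M X Y = \sum_(0 <= i < s) ind (m i).
Proof.
move=> X_bnd Y_bnd Xa mP; apply: eq_big_nat => i /andP[_ i_lt].
by rewrite (residue_value_line X_bnd Y_bnd Xa) // mP.
Qed.

(** * Starting points where the second difference has absolute value [h] *)

Section Extremal.
Hypothesis h_gt2 : (2 < h)%N.

Let M : int := (h%:Z - 1) * d - u * q * h%:Z.
Let X : int := r - u * h%:Z.
(** [X'] is [X + u * q - r], and [Y'] is the shift of 0 by [t * h + 1]. *)
Let X' : int := u * (q - h%:Z).
Let Y' : int := t * h%:Z + 1.

Let uh_bnd : 0 < u * h%:Z < r.
Proof.
have : 0 < u * h%:Z by apply: mulr_gt0; lia.
by have : u * h%:Z < u * q; [rewrite ltr_pM2l; lia | lia].
Qed.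
Let X_bnd : 0 <= X < r. Proof. rewrite /X; lia. Qed.
Let Xa : wrap_at X h.
Proof.
split=> [|i i_lt]; first lia.
rewrite /X; case: (leqP h i) => hi.
  by have : u * h%:Z <= u * i%:Z; [apply: ler_wpM2l; lia | lia].
by have : u * (i%:Z + 1) <= u * h%:Z; [apply: ler_wpM2l; lia | lia].
Qed.
Let X'_bnd : 0 <= X' < r.
Proof.
have : 0 <= u * (q - h%:Z) by apply: mulr_ge0; lia.
by rewrite /X'; lia.
Qed.
Let X'a : wrap_at X' s.
Proof.
apply: wrap_at_none; first by case/andP: X'_bnd.
have sq : 0 <= (s%:Z - 3) * q by apply: mulr_ge0; lia.
have usq : 0 <= u * (s%:Z * q - 2 * q - 2 * h%:Z + 4) by apply: mulr_ge0; lia.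
rewrite /X' sZ; lia.
Qed.
Let Y'_bnd : 0 <= Y' < q.
Proof.
have th : 0 <= t * h%:Z by apply: mulr_ge0; lia.
have : t * h%:Z <= t * s%:Z by apply: ler_wpM2l; lia.
by rewrite /Y'; lia.
Qed.
Let tw0 i : (i < s)%N -> ind (q <= 0 + t * i%:Z) = 0.
Proof.
move=> i_lt; have : t * i%:Z <= t * s%:Z by apply: ler_wpM2l; lia.
by rewrite /ind; lia.
Qed.
Let twY' i : (i < s)%N -> ind (q <= Y' + t * i%:Z) = ind (h <= i)%N.
Proof.
move=> i_lt; congr ind; rewrite /Y'; case: (leqP h i) => hi.
  have : t * (s%:Z + 1) <= t * (h%:Z + i%:Z) by apply: ler_wpM2l; lia.
  lia.
have : t * (h%:Z + i%:Z) <= t * s%:Z by apply: ler_wpM2l; lia.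
lia.
Qed.
Let sd' : (2 * h%:Z - 1) * d = r * q - 1. Proof. by rewrite -sZ. Qed.
Let id_ge (i : nat) : 0 <= i%:Z * d. Proof. by apply: mulr_ge0; lia. Qed.
Let Y'r : Y' * r = h%:Z * d - (u * h%:Z * q - r). Proof. by rewrite /Y' /d; ring. Qed.
Let X'q : X' * q = 2 * d - t - u * q * h%:Z.
Proof. by rewrite -uqq /X'; ring. Qed.
Let Xq : X * q = r * q - u * q * h%:Z. Proof. by rewrite /X; ring. Qed.

Let T := lattice_count s t u q r M.

Let T1 : T X 0 = 0.
Proof.
rewrite /T (@lattice_count_line _ _ _ h (fun=> false)) ?big1 //; first lia.
move=> i i_lt; rewrite tw0 // Xq mul0r !addr0 /M.
case: (leqP h i) => hi; rewrite /ind /= ?mulr1 ?mulr0.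
  have : h%:Z * d <= i%:Z * d by apply: ler_wpM2r; lia.
  lia.
have := id_ge i; lia.
Qed.

Let T2 : T X Y' = h%:Z - 1.
Proof.
rewrite /T (@lattice_count_line _ _ _ h (fun i => h <= i < s)%N) //.
  by rewrite sum_ind_interval; lia.
move=> i i_lt; rewrite twY' // Xq Y'r /M i_lt andbT.
case: (leqP h i) => hi; rewrite /ind /=.
  have : i%:Z * d <= (2 * h%:Z - 2) * d by apply: ler_wpM2r; lia.
  lia.
have := id_ge i; lia.
Qed.

Let T3 : T X' 0 = h%:Z - 2.
Proof.
rewrite /T (@lattice_count_line _ _ _ s (fun i => 0 <= i < h - 2)%N) //; [|lia|].
  by rewrite sum_ind_interval; lia.
move=> i i_lt; rewrite tw0 // X'q mul0r !addr0 /M (_ : ind (s <= i)%N = 0); last by rewrite /ind; lia.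
case: (ltnP i (h - 2)) => hi.
  have : (i%:Z + 2) * d <= (h%:Z - 1) * d by apply: ler_wpM2r; lia.
  lia.
have : h%:Z * d <= (i%:Z + 2) * d by apply: ler_wpM2r; lia.
lia.
Qed.

Let T4 : T X' Y' = h%:Z - 3.
Proof.
rewrite /T (@lattice_count_line _ _ _ s (fun i => h <= i < 2 * h - 3)%N) //.
  by rewrite sum_ind_interval; lia.
move=> i i_lt; rewrite twY' // X'q Y'r /M (_ : ind (s <= i)%N = 0); last by rewrite /ind; lia.
case: (leqP h i) => hi; rewrite /ind /=; last by have := id_ge i; lia.
case: (ltnP i (2 * h - 3)) => hi'.
  have : (i%:Z + 4) * d <= (2 * h%:Z) * d by apply: ler_wpM2r; lia.
  lia.
have : (2 * h%:Z) * d <= (i%:Z + 3) * d by apply: ler_wpM2r; lia.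
lia.
Qed.

Lemma lattice_count_diff_extremal :
  T X 0 - T X' 0 - T X Y' + T X' Y' = - h%:Z.
Proof. rewrite T1 T2 T3 T4; lia. Qed.

End Extremal.

(** * The case [h = 2], where the count [h - 3] above would be negative *)

Section ExtremalTwo.
Hypothesis h_eq2 : h = 2%N.

Let X : int := r - u.
Let X' : int := u * (q - 1).
Let Y : int := q - t.
Let Y' : int := t + 1.

Let s3 : s = 3%N. Proof. by rewrite sE h_eq2. Qed.
Let u_le : u <= u * q. Proof. by apply: ler_peMr; lia. Qed.
Let X_bnd : 0 <= X < r. Proof. rewrite /X; lia. Qed.
Let Xa : wrap_at X 1.
Proof.
split=> [|i i_lt]; first by rewrite s3.
rewrite /X; case: (leqP 1 i) => hi.
  by have : u * 1 <= u * i%:Z; [apply: ler_wpM2l; lia | lia].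
by rewrite (_ : i = 0%N); lia.
Qed.
Let X'_bnd : 0 <= X' < r.
Proof.
have : 0 <= u * (q - 1) by apply: mulr_ge0; lia.
by rewrite /X'; lia.
Qed.
Let X'a : wrap_at X' s.
Proof.
apply: wrap_at_none; first by case/andP: X'_bnd.
have u2 : u * 2 <= u * q by apply: ler_wpM2l; lia.
by have := suq; rewrite /X' s3; lia.
Qed.
Let Y_bnd : 0 <= Y < q. Proof. rewrite /Y; lia. Qed.
Let Y'_bnd : 0 <= Y' < q. Proof. rewrite /Y'; lia. Qed.
Let i3 (i : nat) : (i < s)%N -> [\/ i = 0%N, i = 1%N | i = 2%N].
Proof. by rewrite s3; case: i => [|[|[|]]] //; [constructor 1|constructor 2|constructor 3]. Qed.
Let Xq : X * q = r * q - u * q. Proof. by rewrite /X; ring. Qed.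
Let X'q : X' * q = 2 * d - t - u * q. Proof. by rewrite -uqq /X'; ring. Qed.
Let Yr : Y * r = r * q - t * r. Proof. by rewrite /Y; ring. Qed.
Let Y'r : Y' * r = t * r + r. Proof. by rewrite /Y'; ring. Qed.
Let dE : d = u * q + t * r. Proof. by []. Qed.

Let T := lattice_count s t u q r d.

Let T1 : T X Y = 2.
Proof.
rewrite /T (@lattice_count_line _ _ _ 1 (fun i => 1 <= i < 3)%N) //.
  by rewrite sum_ind_interval ?s3.
move=> i /i3[] ->; rewrite Xq Yr /Y /ind; lia.
Qed.

Let T2 : T X Y' = 0.
Proof.
rewrite /T (@lattice_count_line _ _ _ 1 (fun=> false)) ?big1 //.
move=> i /i3[] ->; rewrite Xq Y'r /Y' /ind; lia.
Qed.

Let T3 : T X' Y = 0.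
Proof.
rewrite /T (@lattice_count_line _ _ _ s (fun=> false)) ?big1 //.
move=> i /i3[] ->; rewrite X'q Yr /Y /ind; lia.
Qed.

Let T4 : T X' Y' = 0.
Proof.
rewrite /T (@lattice_count_line _ _ _ s (fun=> false)) ?big1 //.
move=> i /i3[] ->; rewrite X'q Y'r /Y' /ind; lia.
Qed.

Lemma lattice_count_diff_extremal2 :
  T X Y - T X' Y - T X Y' + T X' Y' = 2.
Proof. by rewrite T1 T2 T3 T4. Qed.

End ExtremalTwo.

(** * Upper bound for the second difference *)

Variables (Y M : int).
Hypotheses (Y_bnd : 0 <= Y < q) (M_lt : M < r * q).

(* The indices at which passing from y to the matched coordinate y - 1 (if
   i < h) or y + 1 (if h <= i) crosses a multiple of q. *)
Definition wraps_below (i : nat) :=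
  (i < h)%N && ((Y + t * i%:Z == 0) || (Y + t * i%:Z == q)).
Definition wraps_above (i : nat) := (h <= i)%N && (Y + t * i%:Z == q - 1).
Local Notation V := wraps_below.
Local Notation U := wraps_above.

(** Between two events [Y + t * i] would rise by [q] or [q - 1], stay constant or decrease; but it
    increases strictly, by at most [t * (s - 1) < q - 2] in all. *)
Lemma events_le1 :
  \sum_(0 <= i < s) ind (V i) + \sum_(0 <= i < s) ind (U i) <= 1.
Proof.
rewrite -big_split /=.
have -> : \sum_(0 <= i < s) (ind (V i) + ind (U i)) = \sum_(0 <= i < s) ind (V i || U i).
  by apply: eq_bigr => i _; rewrite /V /U /ind; lia.
apply: sum_ind_le1 => i j ij.
have ti : t * (i%:Z + 1) <= t * j%:Z by apply: ler_wpM2l; lia.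
have tj : t * j%:Z <= t * (i%:Z + s%:Z - 1) by apply: ler_wpM2l; lia.
by rewrite /V /U; lia.
Qed.

(** At a [plus_index] the line value has passed [r] and its partner has not; at a [minus_index] it
    is the reverse. Hence the signs in [winding]. *)
Definition plus_index (a i : nat) := (h <= i)%N && (i - h < a <= i)%N.
Definition minus_index (a i : nat) := (i < h)%N && (i < a <= i + h - 1)%N.
Definition winding (a i : nat) : int :=
  ind (plus_index a i) - ind (minus_index a i) + ind (V i) - ind (U i).

Definition line_value (X : int) (i : nat) := L (X + u * i%:Z) (Y + t * i%:Z).
(* The value at index i - h (if h <= i) or i + h - 1 (if i < h) of the line
   starting at (X, Y + th + 1): see pair_gapE. *)
Definition paired_value (X : int) (i : nat) :=
  if (h <= i)%N then L (X + u * (i%:Z - h%:Z)) (Y + t * i%:Z + 1)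
  else L (X + u * (i%:Z + h%:Z - 1)) (Y + t * i%:Z - 1).

Local Notation v := line_value.
Local Notation v' := paired_value.

(** Before reduction, passing to the partner changes the value by exactly [- k i]; each reduction
    that only one of the two undergoes adds or removes [r * q]. *)
Lemma paired_valueE X a i : 0 <= X < r -> wrap_at X a -> (i < s)%N ->
  v' X i = v X i - k i + r * q * winding a i.
Proof.
move=> X_bnd [a_bnd aP] i_lt.
have us : u * (s%:Z - 1) < r.
  by have : u * s%:Z * 2 <= u * s%:Z * q; [apply: ler_wpM2l; lia | lia].
have ti0 : 0 <= t * i%:Z by apply: mulr_ge0; lia.
have ti : t * i%:Z <= t * (s%:Z - 1) by apply: ler_wpM2l; lia.
have ui0 : 0 <= u * i%:Z by apply: mulr_ge0; lia.
have ui : u * i%:Z <= u * (s%:Z - 1) by apply: ler_wpM2l; lia.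
rewrite /v /v' /k /winding /plus_index /minus_index /V /U !residue_valueE.
rewrite (@divz_lt2 r (X + u * i%:Z)) ?(@divz_lt2 q (Y + t * i%:Z)) ?aP //; try lia.
case: (leqP h i) => hi /=.
  have uj : u * (i%:Z - h%:Z) = u * (i - h)%N%:Z by congr (_ * _); lia.
  have uj0 : 0 <= u * (i - h)%N%:Z by apply: mulr_ge0; lia.
  have uj1 : u * (i - h)%N%:Z <= u * (s%:Z - 1) by apply: ler_wpM2l; lia.
  rewrite uj (@divz_lt2 r) ?aP; try lia.
  rewrite (@divz_lt2 q); last by lia.
  have -> : u * (i - h)%N%:Z = u * i%:Z - u * h%:Z by rewrite -uj; ring.
  have -> : ind (q <= Y + t * i%:Z + 1) = ind (q <= Y + t * i%:Z) + ind (Y + t * i%:Z == q - 1).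
    by rewrite /ind; lia.
  have -> : ind (i - h < a <= i)%N = ind (a <= i)%N - ind (a <= i - h)%N by rewrite /ind; lia.
  by rewrite /ind /=; ring.
have uj : u * (i%:Z + h%:Z - 1) = u * (i + h - 1)%N%:Z by congr (_ * _); lia.
have uj0 : 0 <= u * (i + h - 1)%N%:Z by apply: mulr_ge0; lia.
have uj1 : u * (i + h - 1)%N%:Z <= u * (s%:Z - 1) by apply: ler_wpM2l; lia.
rewrite uj (@divz_lt2 r) ?aP; try lia.
have -> : u * (i + h - 1)%N%:Z = u * i%:Z + u * (h%:Z - 1) by rewrite -uj; ring.
(* At [Y + t * i = 0] the quotient is -1, a case outside [divz_lt2]. *)
have -> : ((Y + t * i%:Z - 1) %/ q)%Z =
  ind (q <= Y + t * i%:Z) - ind ((Y + t * i%:Z == 0) || (Y + t * i%:Z == q)).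
  case: (eqVneq (Y + t * i%:Z) 0) => [->|y0].
    by rewrite sub0r divzN1 /ind; lia.
  by rewrite divz_lt2 /ind; lia.
have -> : ind (i < a <= i + h - 1)%N = ind (a <= i + h - 1)%N - ind (a <= i)%N by rewrite /ind; lia.
by rewrite /ind /=; ring.
Qed.

Lemma line_value_wrap X a i : 0 <= X < r -> wrap_at X a -> (i < s)%N ->
  v X i = X * q + Y * r + i%:Z * d
          - r * q * (ind (a <= i)%N + ind (q <= Y + t * i%:Z)).
Proof. by move=> X_bnd Xa i_lt; exact: residue_value_line. Qed.

(** The values differ by [(j - i) * d] modulo [r * q], and [d <= (j - i) * d <= (s - 1) * d < r * q
    - d]. *)
Lemma line_value_sep X i j : (i < j < s)%N -> d <= `|v X j - v X i|.
Proof.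
move=> ij; rewrite /v !residue_valueE.
set A := (_ %/ r)%Z + _; set B := (_ %/ r)%Z + _; move: A B => A B.
have -> : (X + u * j%:Z) * q + (Y + t * j%:Z) * r - r * q * A
   - ((X + u * i%:Z) * q + (Y + t * i%:Z) * r - r * q * B)
   = (j%:Z - i%:Z) * d - (r * q) * (A - B) by rewrite /d; ring.
have le1 : 1 * d <= (j%:Z - i%:Z) * d by apply: ler_wpM2r; lia.
have le2 : (j%:Z - i%:Z) * d <= (s%:Z - 1) * d by apply: ler_wpM2r; lia.
have rq0 : 0 <= r * q by apply: mulr_ge0; lia.
have [ab|ab] : A - B <= 0 \/ 1 <= A - B by lia.
  by have : r * q * (A - B) <= 0; [apply: mulr_ge0_le0 | lia].
by have : r * q <= r * q * (A - B); [apply: ler_peMr | lia].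
Qed.

(** Two crossings would bring two values of the line closer than [d]. *)
Lemma crossing_unique X i j : (i < j < s)%N -> v X i - k i <= M < v X i ->
  v X j - k j <= M < v X j -> False.
Proof. by move=> /(line_value_sep X); have := k_lt_d i; have := k_lt_d j; lia. Qed.

Definition pair_gap (X : int) : int :=
  \sum_(0 <= i < s) (ind (v X i <= M) - ind (v' X i <= M)).
Local Notation E := pair_gap.

Let kQ i : 0 <= k i <= r * q.
Proof. by have := k_bnd i; have := d_lt; have := d_gt; lia. Qed.

Lemma winding_bnd a i : -1 <= winding a i <= 1.
Proof. by rewrite /winding /plus_index /minus_index /V /U /ind; lia. Qed.

Section Wrap.
Variables (X : int) (a : nat).
Hypotheses (X_bnd : 0 <= X < r) (Xa : wrap_at X a).

Lemma pair_gap_ub : E X <= \sum_(0 <= i < s) ind (winding a i == 1).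
Proof.
apply: (@comparison_ub _ _ _ k _ M (r * q)) => i i_lt.
- exact: paired_valueE.
- exact: kQ.
- exact: winding_bnd.
Qed.

Lemma pair_gap_lb : - \sum_(0 <= i < s) ind (winding a i == -1) - 1 <= E X.
Proof.
apply: (@comparison_lb _ _ _ k _ M (r * q)) => [i i_lt|i _|i _|i j ij].
- exact: paired_valueE.
- exact: kQ.
- exact: winding_bnd.
- exact: crossing_unique ij.
Qed.

Lemma pair_gap_lb_no_crossing :
  (forall i, (i < s)%N -> winding a i = 0 -> v X i - k i <= M < v X i -> False) ->
  - \sum_(0 <= i < s) ind (winding a i == -1) <= E X.
Proof.
apply: (@comparison_lb_no_crossing _ _ _ k _ M (r * q)) => [i i_lt|i _|i _].
- exact: paired_valueE.
- exact: kQ.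
- exact: winding_bnd.
Qed.

Lemma sum_plus_index : \sum_(0 <= i < s) ind (plus_index a i) = (minn a (s - a))%:Z.
Proof.
have [a_bnd _] := Xa.
rewrite (eq_big_nat _ _ (F2 := fun i => ind (maxn h a <= i < minn (a + h) s)%N)).
  by rewrite sum_ind_interval; lia.
by move=> i i_lt; congr ind; rewrite /plus_index; lia.
Qed.

Lemma sum_minus_index : \sum_(0 <= i < s) ind (minus_index a i) = (minn a (s - a))%:Z.
Proof.
have [a_bnd _] := Xa.
rewrite (eq_big_nat _ _ (F2 := fun i => ind (a.+1 - h <= i < minn h a)%N)).
  by rewrite sum_ind_interval; lia.
by move=> i i_lt; congr ind; rewrite /minus_index; lia.
Qed.

End Wrap.

Let nV := \sum_(0 <= i < s) ind (V i).
Let nU := \sum_(0 <= i < s) ind (U i).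

Let nU_ge0 : 0 <= nU. Proof. by apply: sumr_ge0. Qed.

Let winding_le_plus a i : ind (winding a i == 1) <= ind (plus_index a i) + ind (V i).
Proof.
rewrite /winding; case: (plus_index a i) (minus_index a i) (V i) (U i);
by do 3!case.
Qed.

Let winding_le_minus a i : ind (winding a i == -1) <= ind (minus_index a i) + ind (U i).
Proof.
rewrite /winding; case: (plus_index a i) (minus_index a i) (V i) (U i);
by do 3!case.
Qed.

(** The wrap of the first coordinate causes [minn a (s - a)] windings of each sign, to which events
    are added; the extra 1 is the single possible crossing. *)
Lemma pair_gap_bounds X a : 0 <= X < r -> wrap_at X a ->
  - (minn a (s - a))%:Z - nU - 1 <= E X <= (minn a (s - a))%:Z + nV.
Proof.
move=> X_bnd Xa; apply/andP; split.
  apply: le_trans (pair_gap_lb X_bnd Xa); rewrite lerB // -opprD lerN2.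
  rewrite -(sum_minus_index X_bnd Xa) -big_split; apply: ler_sum => i _; exact: winding_le_minus.
apply: le_trans (pair_gap_ub X_bnd Xa) _.
rewrite -(sum_plus_index X_bnd Xa) -big_split; apply: ler_sum => i _; exact: winding_le_plus.
Qed.

(** For [X2] the minimum is 0, so the difference is at most [h - 2] plus one event plus one
    crossing. *)
Lemma pair_gap_diff_easy X1 X2 a : 0 <= X1 < r -> 0 <= X2 < r ->
  wrap_at X1 a -> wrap_at X2 s -> (minn a (s - a) <= h - 2)%N ->
  `|E X1 - E X2| <= h%:Z.
Proof.
move=> X1_bnd X2_bnd X1a X2s c_le.
have := pair_gap_bounds X1_bnd X1a; have := pair_gap_bounds X2_bnd X2s.
by have := events_le1; rewrite -/nV -/nU; lia.
Qed.

(* When the wrap splits the indices in halves of sizes h and h - 1, every index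
   other than z has plus_index or minus_index, so that an event at z leaves no
   pair with winding number 0. *)
Section Middle.
Variables (X1 X2 : int) (a z : nat).
Hypotheses (X1_bnd : 0 <= X1 < r) (X2_bnd : 0 <= X2 < r)
  (X1a : wrap_at X1 a) (X2s : wrap_at X2 s)
  (az : (a, z) = (h, 0%N) \/ (a, z) = (h.-1, h.-1))
  (X12 : X2 = X1 + u * q - r \/ X2 = X1 - u * q).

Let az' : a = h /\ z = 0%N \/ a = h.-1 /\ z = h.-1.
Proof. by case: az => -[-> ->]; [left|right]. Qed.

Let z_lt : (z < h)%N. Proof. lia. Qed.

Let sum_z f : \sum_(0 <= i < s) ind (i == z) * f i = f z.
Proof. by rewrite sum_ind_eq ifT //; lia. Qed.

Let sum_ge_h : \sum_(0 <= i < s) ind (h <= i)%N = h%:Z - 1.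
Proof.
rewrite (eq_big_nat _ _ (F2 := fun i => ind (h <= i < s)%N)).
  by rewrite sum_ind_interval; lia.
by move=> i i_lt; congr ind; lia.
Qed.

Let sum_lt_h : \sum_(0 <= i < s) ind ((i < h)%N && (i != z)) = h%:Z - 1.
Proof.
have : \sum_(0 <= i < s) ind ((i < h)%N && (i != z)) + ind (z < h)%N = h%:Z.
  rewrite -(sum_z (fun i => ind (i < h)%N)) -big_split /=.
  rewrite (eq_big_nat _ _ (F2 := fun i => ind (0 <= i < h)%N)).
    by rewrite sum_ind_interval; lia.
  by move=> i i_lt; rewrite /ind; case: eqP => [->|_]; rewrite ?mul0r ?mul1r; lia.
by rewrite z_lt /ind; lia.
Qed.

Let winding_mid i : (i < s)%N ->
  winding a i = (if (h <= i)%N then 1 else if i == z then 0 else -1)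
             + ind (V i) - ind (U i).
Proof.
move=> i_lt; rewrite /winding /V /U; congr (_ + _ - _).
by rewrite /plus_index /minus_index /ind; case: (leqP h i) => hi; case: (eqVneq i z); lia.
Qed.

Let mid_excl i : [/\ V i ==> ~~ (h <= i)%N, U i ==> (h <= i)%N
  & (i == z) ==> ~~ (h <= i)%N].
Proof.
split; rewrite -?ltnNge.
- by apply/implyP => /andP[].
- by apply/implyP => /andP[].
- by apply/implyP => /eqP ->.
Qed.

(** An event in [U] cancels one of the [h - 1] positive windings; an event in [V] creates a new one
    only at [z]. *)
Let pos_le : \sum_(0 <= i < s) ind (winding a i == 1) <= h%:Z - 1 - nU + ind (V z).
Proof.
rewrite -sum_ge_h -(sum_z (fun i => ind (V i))) -sumrB -big_split /=.
apply: ler_sum_nat => i i_lt; rewrite winding_mid; last by lia.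
have [hV hU hz] := mid_excl i; move: hV hU hz.
by case: (h <= i)%N; case: (V i); case: (U i); case: (i == z).
Qed.

Let neg_le : \sum_(0 <= i < s) ind (winding a i == -1) <= h%:Z - 1 - nV + ind (V z).
Proof.
rewrite -sum_lt_h -(sum_z (fun i => ind (V i))) -sumrB -big_split /=.
apply: ler_sum_nat => i i_lt; rewrite winding_mid; last by lia.
have [hV hU hz] := mid_excl i; move: hV hU hz; rewrite ltnNge.
by case: (h <= i)%N; case: (V i); case: (U i); case: (i == z).
Qed.

Let wrapX1 i : (i < s)%N -> (r <= X1 + u * i%:Z) = (a <= i)%N.
Proof. by have [_ aP] := X1a; apply: aP. Qed.

(** An event away from [z] cancels a winding for [X1], tightening the bound on [E X1] by as much as
    it loosens the one on [E X2]. *)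
Lemma pair_gap_diff_middle_noV : ~~ V z -> `|E X1 - E X2| <= h%:Z.
Proof.
move=> /negbTE Vz.
have := pair_gap_bounds X2_bnd X2s; have := pair_gap_ub X1_bnd X1a.
have := pair_gap_lb X1_bnd X1a.
by have := pos_le; have := neg_le; rewrite Vz /ind; lia.
Qed.

Section EventAtMiddle.
Hypothesis Vz : V z.

Let events : nV = 1 /\ nU = 0.
Proof.
have : \sum_(0 <= i < s) ind (i == z) * ind (V i) <= nV.
  by apply: ler_sum => i _; case: (i == z) (V i) => -[].
by rewrite sum_z Vz; have := events_le1; rewrite -/nV -/nU /ind; lia.
Qed.

Let event_V i : (i < s)%N -> V i = (i == z).
Proof.
have [V1 _] := events.
have eqV : forall i, (i < s)%N -> ind (i == z) * ind (V i) = ind (V i).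
  apply: sum_eq_pointwise; first by move=> j _; case: (j == z) (V j) => -[].
  by rewrite sum_z Vz -/nV V1.
move=> i_lt; have := eqV i i_lt; case: (eqVneq i z) => [->|_] //.
by case: (V i).
Qed.

Let event_U i : (i < s)%N -> U i = false.
Proof.
have [_ U0] := events.
have eqU : forall i, (i < s)%N -> 0 = ind (U i).
  by apply: sum_eq_pointwise; [move=> j _; case: (U j) | rewrite -/nU U0 big1].
by move=> i_lt; have := eqU i i_lt; case: (U i).
Qed.

Let winding1 i : (i < s)%N -> winding a i = if (h <= i)%N || (i == z) then 1 else -1.
Proof.
move=> i_lt; rewrite winding_mid // event_V // event_U //.
have [_ _] := mid_excl i.
by case: (h <= i)%N; case: (i == z).
Qed.

Let winding2 i : (i < s)%N -> winding s i = ind (i == z).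
Proof.
move=> i_lt; rewrite /winding event_V // event_U // /plus_index /minus_index /ind.
by case: (i == z); lia.
Qed.

(** The only winding for [X2] is the positive one at [z], so only crossings elsewhere could
    contribute -1. *)
Let gap2_ge0_no_crossing :
  (forall i, (i < s)%N -> i != z -> v X2 i - k i <= M < v X2 i -> False) ->
  0 <= E X2.
Proof.
move=> ncr; have : - \sum_(0 <= i < s) ind (winding s i == -1) <= E X2.
  apply: pair_gap_lb_no_crossing => // i i_lt; rewrite winding2 // => iz.
  by apply: ncr => //; apply: contra_eqN iz => ->.
rewrite big_nat_cond big1 ?oppr0 // => i /andP[/andP[_ i_lt] _].
by rewrite winding2 //; case: (i == z).
Qed.

(** The pair at [z] contributes 1, and at most one crossing takes it back. *)
Let gap2_ge0_at_z : v X2 z <= M < v X2 z - k z + r * q -> 0 <= E X2.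
Proof.
move=> vz.
have cr1 : \sum_(0 <= i < s) ind (v X2 i - k i <= M < v X2 i) <= 1.
  by apply: sum_ind_le1 => i j ij ci cj; apply: (crossing_unique ij ci cj).
have : 1 - \sum_(0 <= i < s) ind (v X2 i - k i <= M < v X2 i) <= E X2.
  have <- : \sum_(0 <= i < s) ind (i == z) * 1 = 1 by rewrite (sum_z (fun=> 1)).
  rewrite -sumrB; apply: ler_sum_nat => i i_lt.
  rewrite mulr1 (paired_valueE X2_bnd X2s) ?winding2; try lia.
  have := k_bnd i; case: (eqVneq i z) => [->|_]; last by rewrite mulr0 /ind; lia.
  by rewrite mulr1 /ind; lia.
lia.
Qed.

(** The bound [h] on [E X1] holds term by term, so reaching it fixes the contribution of every
    pair. *)
Let gap1_extremal i : h%:Z <= E X1 -> (i < s)%N ->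
  ind (v X1 i <= M) = ind (v' X1 i <= M) + ind ((h <= i)%N || (i == z)).
Proof.
move=> E_ge i_lt.
pose g i := ind (h <= i)%N + ind (i == z) * 1.
have eqE : forall i, (i < s)%N -> ind (v X1 i <= M) - ind (v' X1 i <= M) = g i.
  apply: sum_eq_pointwise => [j j_lt|]; last first.
    by apply: le_trans E_ge; rewrite /g big_split /= sum_ge_h (sum_z (fun=> 1)); lia.
  rewrite (paired_valueE X1_bnd X1a) // winding1 // /g.
  have [_ _] := mid_excl j; have := kQ j; rewrite /ind.
  by case: (h <= j)%N; case: (j == z) => //=; rewrite ?mulr1 ?mulrN1; lia.
move: (eqE i i_lt); have [_ _] := mid_excl i.
by rewrite /g; case: (h <= i)%N; case: (i == z) => //=; rewrite /ind; lia.
Qed.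

(** The difference could exceed [h] only if [E X1 = h] and [E X2 = -1]; what the first says about
    [M] excludes the second. *)
Let not_extremal : h%:Z <= E X1 -> E X2 <= -1 -> False.
Proof.
move=> E1 E2; have kz : k z = r - u * (h%:Z - 1) * q by rewrite /k leqNgt z_lt.
have v1z : v X1 z <= M by have := gap1_extremal E1 (_ : z < s)%N; rewrite eqxx orbT /ind; lia.
have Vz' : Y + t * z%:Z = 0 \/ Y + t * z%:Z = q by move: Vz; rewrite /V; lia.
have [[ah z0]|[ah zh]] := az'.
  have X1h : r <= X1 + u * h%:Z by rewrite wrapX1; lia.
  have Y0 : Y = 0 by move: Vz'; rewrite z0; lia.
  have v1 : X1 * q <= M.
    move: v1z; rewrite (line_value_wrap X1_bnd X1a); last by lia.
    rewrite z0 Y0 /ind; lia.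
  suff : 0 <= E X2 by lia.
  (* Here [X2 <= X1] gives [v X2 z <= M], and [M < r * q] gives the other bound once
     [k z <= X2 * q]. *)
  apply: gap2_ge0_at_z.
  have -> : v X2 z = X2 * q.
    by rewrite (line_value_wrap X2_bnd X2s); [rewrite z0 Y0 /ind; lia | lia].
  have X2_le : X2 * q <= X1 * q by apply: ler_wpM2r; lia.
  suff : k z <= X2 * q by lia.
  have kz' := k_bnd z.
  case: X12 => X2E.
    have : u * (h%:Z + 1) <= u * q by apply: ler_wpM2l; lia.
    move=> uh; have : u * q <= X2 * q by apply: ler_wpM2r; lia.
    lia.
  have s_gt0 : 0 < s%:Z by lia.
  rewrite -(ler_pM2l s_gt0).
  have sq : 0 <= (s%:Z - 3) * (q - 1) by apply: mulr_ge0; lia.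
  have usq : 0 <= u * (s%:Z * q - s%:Z - 2 * q - 2) by apply: mulr_ge0; lia.
  (* Doubling brings in [2 * r = 1 + u * s * q], for comparison with
     [2 * s * k z <= u * s * q + s]. *)
  have X2_ge : 1 + u <= 2 * X2 by rewrite X2E; lia.
  have : s%:Z * q * (1 + u) <= s%:Z * q * (2 * X2) by apply: ler_wpM2l => //; apply: mulr_ge0; lia.
  have s_le : s%:Z <= s%:Z * q by apply: ler_peMr; lia.
  by have := kE z; lia.
(* The reduced first coordinate at index [h - 1], where both coordinates pass their moduli at
   once. *)
pose x := X1 + u * (h%:Z - 1) - r.
have Yz : Y + t * (h%:Z - 1) = q.
  have : 0 < t * (h%:Z - 1) by apply: mulr_gt0; lia.
  by move: Vz'; rewrite zh (_ : h.-1%:Z = h%:Z - 1); lia.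
have base : X1 * q + Y * r = x * q + 2 * (r * q) - (h%:Z - 1) * d.
  by rewrite (_ : Y = q - t * (h%:Z - 1)); [rewrite /x /d; ring | lia].
have tw (i : nat) : (q <= Y + t * i%:Z) = (h.-1 <= i)%N.
  case: (leqP h.-1 i) => hi.
    have : t * (h%:Z - 1) <= t * i%:Z by apply: ler_wpM2l; lia.
    lia.
  have : t * (i%:Z + 1) <= t * (h%:Z - 1) by apply: ler_wpM2l; lia.
  lia.
have xq : 0 <= x * q.
  by apply: mulr_ge0; last lia; have := wrapX1 (_ : h.-1 < s)%N; rewrite /x ah; lia.
(* The pair at [s - 1] contributes 1, so [v X1 (s - 1) <= M]; the pair at 0 contributes 0, so its
   partner, like its value, exceeds [M]. This encloses [M] in an interval of length at most [d]. *)
have last_le : x * q + (h%:Z - 1) * d <= M.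
  have : v X1 s.-1 <= M.
    by have := gap1_extremal E1 (_ : s.-1 < s)%N; rewrite /ind; lia.
  rewrite (line_value_wrap X1_bnd X1a) ?tw ?ah; try lia.
  have -> : ind (h.-1 <= s.-1)%N = 1 by rewrite /ind; lia.
  have -> : s.-1%:Z = (h%:Z - 1) + (h%:Z - 1) by lia.
  by rewrite mulrDl; lia.
have M_ub : M < x * q + h%:Z * d + 1 - k z.
  have k0 : k 0%N = k z by rewrite /k !(leqNgt h) z_lt (_ : 0 < h)%N //; lia.
  have z0 : ((h <= 0)%N || (0%N == z)) = false by lia.
  have w0 : winding a 0%N = -1 by rewrite winding1 ?z0 //; lia.
  have s_gt0 : (0 < s)%N by lia.
  have := gap1_extremal E1 s_gt0.
  rewrite (paired_valueE X1_bnd X1a) ?w0; try lia.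
  rewrite (line_value_wrap X1_bnd X1a) ?tw ?ah; try lia.
  have -> : ind (h.-1 <= 0)%N = 0 by rewrite /ind; lia.
  have sd' : (2 * h%:Z - 1) * d = r * q - 1 by rewrite -sZ.
  rewrite z0 mul0r addr0 add0r mulr0 subr0 mulrN1 k0 base /ind.
  have kz_lt := k_bnd z; 
  have -> : (x * q + 2 * (r * q) - (h%:Z - 1) * d <= M) = false.
    have hd : h%:Z * d <= (2 * h%:Z - 1) * d by apply: ler_wpM2r; lia.
    lia.
  lia.
have sd' : (2 * h%:Z - 1) * d = r * q - 1 by rewrite -sZ.
have k_lt_z i : (h <= i)%N -> k i < k z.
  have usq' : u * (2 * h%:Z - 1) * q = 2 * r - 1 by rewrite -sZ; lia.
  by rewrite kz /k => -> /=; lia.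
have v2 i : (i < s)%N ->
  v X2 i = X2 * q + Y * r + i%:Z * d - r * q * ind (h.-1 <= i)%N.
  move=> i_lt; rewrite (line_value_wrap X2_bnd X2s) // tw.
  by rewrite (_ : ind (s <= i)%N = 0) ?add0r // /ind; lia.
(* Before the second coordinate is reduced, the values are too large for a crossing. *)
have no_cross_left i : (i < h.-1)%N -> v X2 i - k i <= M -> False.
  move=> i_lt; rewrite v2; last by lia.
  rewrite (_ : ind _ = 0) ?mulr0 ?subr0; last by rewrite /ind; lia.
  have id0 : 0 <= i%:Z * d by apply: mulr_ge0; lia.
  have hd : 3 * d <= (2 * h%:Z - 1) * d by apply: ler_wpM2r; lia.
  have := k_bnd i; have := k_bnd z.
  by case: X12 => ->; lia.
suff : 0 <= E X2 by lia.
case: X12 => X2E.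
  have vz : v X2 z = x * q + 2 * d - t.
    rewrite v2; last by lia.
    rewrite (_ : ind _ = 1); last by rewrite /ind; lia.
    by rewrite (_ : z%:Z = h%:Z - 1) ?X2E; lia.
  (* For [h >= 3] the pair at [z] makes up for a crossing; for [h = 2] only index 2 remains to be
     inspected. *)
  case: (leqP 3 h) => h3.
    apply: gap2_ge0_at_z.
    have : 2 * d <= (h%:Z - 1) * d by apply: ler_wpM2r; lia.
    by have := k_lt_d z; lia.
  have h2 : h = 2 by lia.
  apply: gap2_ge0_no_crossing => i i_lt iz /andP[vi _].
  case: (ltnP i h.-1) => hi; first by apply: no_cross_left vi.
  move: vi; rewrite v2 // (_ : ind _ = 1); last by rewrite /ind; lia.
  rewrite (_ : i%:Z = 2); last by lia.
  by have := k_lt_z i; have := d_gt; rewrite X2E; lia.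
apply: gap2_ge0_no_crossing => i i_lt iz /andP[vi _].
case: (ltnP i h.-1) => hi; first by apply: no_cross_left vi.
move: vi; rewrite v2 // (_ : ind _ = 1); last by rewrite /ind; lia.
have id_ge : h%:Z * d <= i%:Z * d by apply: ler_wpM2r; lia.
have hd : h%:Z * d + d <= (2 * h%:Z - 1) * d.
  by rewrite -[X in _ + X]mul1r -mulrDl; apply: ler_wpM2r; lia.
by have := k_lt_z i; rewrite X2E; lia.
Qed.

Lemma pair_gap_diff_middle_V : `|E X1 - E X2| <= h%:Z.
Proof.
have [V1 U0] := events.
have E1_lb : - \sum_(0 <= i < s) ind (winding a i == -1) <= E X1.
  apply: pair_gap_lb_no_crossing => // i i_lt; rewrite winding1 //.
  by case: ifP.
have := pair_gap_bounds X2_bnd X2s; have := pair_gap_ub X1_bnd X1a.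
have := pos_le; have := neg_le; have := not_extremal.
by rewrite V1 U0 Vz (_ : ind true = 1) //; lia.
Qed.

End EventAtMiddle.

End Middle.

Lemma pair_gap_diff X1 X2 a : 0 <= X1 < r -> 0 <= X2 < r ->
  wrap_at X1 a -> wrap_at X2 s -> X2 = X1 + u * q - r \/ X2 = X1 - u * q ->
  `|E X1 - E X2| <= h%:Z.
Proof.
move=> X1_bnd X2_bnd X1a X2s X12; have [a_bnd _] := X1a.
case: (leqP (minn a (s - a)) (h - 2)) => c_le.
  exact: pair_gap_diff_easy X1a X2s c_le.
have [z az] : exists z, (a, z) = (h, 0%N) \/ (a, z) = (h.-1, h.-1).
  have [->|->] : a = h \/ a = h.-1 by lia.
    by exists 0%N; left.
  by exists h.-1; right.
case: (boolP (V z)) => Vz; first exact: (@pair_gap_diff_middle_V X1 X2 a z).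
exact: (@pair_gap_diff_middle_noV X1 X2 a z).
Qed.

Lemma wrap_at_exists X : X < r -> exists a, wrap_at X a.
Proof.
move=> X_lt; have exP : exists a, (a == s) || (r <= X + u * a%:Z) by exists s; rewrite eqxx.
case: (ex_minnP exP) => a aP a_min; exists a; split.
  have := a_min s; rewrite eqxx => /(_ isT) ->; rewrite andbT lt0n.
  by apply: contraL aP => /eqP->; rewrite mulr0 addr0; lia.
move=> i i_lt; case: (leqP a i) => ai; last first.
  by apply: contraTF ai => ri; rewrite -leqNgt a_min ?ri ?orbT.
move: aP; rewrite ltn_eqF /= => [ra|]; last by lia.
have ui : u * a%:Z <= u * i%:Z by apply: ler_wpM2l; lia.
by lia.
Qed.

(** One of the two lines never wraps, and serves as [X2] in [pair_gap_diff]: that of [X] if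
    [X + u * q < r], that of the shift otherwise. *)
Lemma pair_gap_shift X : 0 <= X < r ->
  `|E X - E ((X + u * q) %% r)%Z| <= h%:Z.
Proof.
move=> X_bnd.
have us : u * (s%:Z - 1) <= u * q by apply: ler_wpM2l; lia.
case: (ltrP (X + u * q) r) => Xuq.
  rewrite modz_small; last by lia.
  have [a Xa] := wrap_at_exists Xuq.
  rewrite distrC; apply: pair_gap_diff Xa _ _; try lia.
  by apply: wrap_at_none; lia.
have -> : ((X + u * q) %% r)%Z = X + u * q - r.
  by rewrite -{1}(subrK r (X + u * q)) modzDr modz_small; lia.
have [a Xa] := wrap_at_exists (proj2 (andP X_bnd)).
apply: pair_gap_diff Xa _ _; try lia.
apply: wrap_at_none; first lia.
have sq : 0 <= (s%:Z - 3) * (q - 2) by apply: mulr_ge0; lia.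
have usq : 0 <= u * (s%:Z * q - 2 * s%:Z - 2 * q + 2) by apply: mulr_ge0; lia.
lia.
Qed.

Local Notation T := (lattice_count s t u q r M).

(** The partners run once through the shifted line: indices from [h] on move down by [h], the others
    up by [h - 1], where [t * s + 1 = q - 1] makes the second coordinate change by -1. *)
Lemma pair_gapE X : E X = T X Y - T X (Y + t * h%:Z + 1).
Proof.
rewrite /E sumrB; congr (_ - _).
pose f j := ind (L (X + u * j%:Z) (Y + t * h%:Z + 1 + t * j%:Z) <= M).
rewrite /lattice_count -/(f _) (@big_cat_nat _ _ _ h) /=; try lia.
rewrite [RHS](@big_cat_nat _ _ _ h.-1) /=; try lia.
rewrite addrC; congr (_ + _).
  rewrite -{1}(add0n h) big_addn (_ : s - h = h.-1)%N; last by lia.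
  apply: eq_big_nat => i i_lt; rewrite /v' leq_addl; congr (ind (L _ _ <= _)).
    by rewrite PoszD addrK.
  by rewrite PoszD; ring.
rewrite -{1}(add0n h.-1) big_addn (_ : s - h.-1 = h)%N; last by lia.
apply: eq_big_nat => i /andP[_ i_lt]; rewrite /v' leqNgt i_lt /residue_value /=.
have -> : (i + h.-1)%N%:Z = i%:Z + h%:Z - 1 by lia.
have -> : Y + t * h%:Z + 1 + t * (i%:Z + h%:Z - 1) = q + (Y + t * i%:Z - 1).
  by rewrite qE sZ; ring.
by rewrite modzDl.
Qed.

End UpperBound.

Lemma lattice_count_diff_le (h s : nat) (t u q r x x' y y' M : int) :
  (1 < h)%N -> s = (2 * h - 1)%N -> 0 < t -> 0 < u -> q = t * s%:Z + 2 ->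
  2 * r = 1 + u * s%:Z * q -> M < r * q ->
  (x' = x + u * q %[mod r])%Z -> (y' = y + t * h%:Z + 1 %[mod q])%Z ->
  `|lattice_count s t u q r M x y - lattice_count s t u q r M x' y
    - lattice_count s t u q r M x y' + lattice_count s t u q r M x' y'| <= h%:Z.
Proof.
move=> h1 sE t0 u0 qE rE M_lt xx' yy'.
have q0 : 0 < q by rewrite qE; have : 0 <= t * s%:Z; [apply: mulr_ge0; lia | lia].
have r0 : 0 < r.
  have : 0 <= u * s%:Z * q by rewrite !mulr_ge0 //; lia.
  by move: rE; clear; lia.
pose X := (x %% r)%Z; pose X' := ((X + u * q) %% r)%Z; pose Y := (y %% q)%Z.
have X_bnd : 0 <= X < r by rewrite modz_ge0 ?ltz_pmod; lia.
have Y_bnd : 0 <= Y < q by rewrite modz_ge0 ?ltz_pmod; lia.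
have := pair_gap_shift h1 sE t0 u0 qE rE Y_bnd M_lt X_bnd.
rewrite !(pair_gapE h1 sE t0 u0 qE rE Y_bnd M_lt).
have xX : (x = X %[mod r])%Z by rewrite modz_mod.
have xX' : (x' = X' %[mod r])%Z by rewrite modz_mod modzDml.
have yY : (y = Y %[mod q])%Z by rewrite modz_mod.
have yY' : (y' = Y + t * h%:Z + 1 %[mod q])%Z by rewrite yy' -(addrA y) -(addrA Y) modzDml.
rewrite (eq_lattice_count _ _ _ _ xX yY) (eq_lattice_count _ _ _ _ xX' yY).
rewrite (eq_lattice_count _ _ _ _ xX yY') (eq_lattice_count _ _ _ _ xX' yY').
by apply: le_trans; rewrite le_eqVlt; apply/orP; left; apply/eqP; congr `|_|; ring.
Qed.

Lemma residue_value_pred (q r x y : int) : 0 < q -> 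
  residue_value q r x (y - 1) =
  residue_value q r x y + (if (y %% q)%Z == 0 then (q - 1) * r else - r).
Proof.
move=> q0; have y_ge := modz_ge0 y (lt0r_neq0 q0); have y_lt := ltz_pmod y q0.
rewrite /residue_value -(modzDml y); case: eqP => [->|y_neq].
  rewrite (_ : ((0 - 1)%R %% q)%Z = q - 1); first by ring.
  by rewrite -(modzDr _ q) modz_small; lia.
by rewrite [((_ - 1) %% q)%Z]modz_small; [ring | lia].
Qed.

(** The case [h = 1]: whether the value rises or falls from [y] to [y - 1] depends on [y] alone, so
    the differences at [x] and [x'] cannot have opposite signs. *)
Lemma lattice_count_diff_le1 (t u q r x x' y y' M : int) :
  0 < q -> 0 < r -> (y' = y - 1 %[mod q])%Z ->
  `|lattice_count 1 t u q r M x y - lattice_count 1 t u q r M x' y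
    - lattice_count 1 t u q r M x y' + lattice_count 1 t u q r M x' y'| <= 1.
Proof.
move=> q0 r0 yy'.
have e z : lattice_count 1 t u q r M z y' = lattice_count 1 t u q r M z (y - 1).
  exact: eq_lattice_count.
rewrite !e /lattice_count !big_nat1 !mulr0 !addr0 !residue_value_pred //.
have qr : 0 <= (q - 1) * r by apply: mulr_ge0; lia.
by case: ifP => _; rewrite /ind; lia.
Qed.

Lemma lattice_count_diff_bound (h s : nat) (t u q r x x' y y' M : int) :
  (0 < h)%N -> s = (2 * h - 1)%N -> 0 < t -> 0 < u -> q = t * s%:Z + 2 ->
  2 * r = 1 + u * s%:Z * q -> M < r * q ->
  (x' = x + u * q %[mod r])%Z -> (y' = y + t * h%:Z + 1 %[mod q])%Z ->
  `|lattice_count s t u q r M x y - lattice_count s t u q r M x' y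
    - lattice_count s t u q r M x y' + lattice_count s t u q r M x' y'| <= h%:Z.
Proof.
move=> h0 sE t0 u0 qE rE M_lt.
case: (ltnP 1 h) => h1; first by move=> xx' yy'; exact: (lattice_count_diff_le h1 sE).
have hE : h = 1%N by lia.
have s1 : s = 1%N by lia.
rewrite {}hE {}s1 in qE rE sE *; rewrite mulr1 in qE rE.
have r0 : 0 < r.
  have : 0 < u * q by rewrite mulr_gt0 //; lia.
  by move: rE; clear; lia.
move=> _ yy'; apply: lattice_count_diff_le1; rewrite ?yy' //; first lia.
(* Here [q = t + 2], so the shift [t + 1] is -1 modulo [q]. *)
by rewrite -(modzDr (y - 1) q) qE; congr (_ %% _)%Z; ring.
Qed.

(** * Cyclotomic identities *)

Lemma perm_divisors_prime_mul (p n : nat) : prime p -> ~~ (p %| n)%N -> (0 < n)%N ->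
  perm_eq (divisors (p * n)) (divisors n ++ map (muln p) (divisors n)).
Proof.
move=> p_pr pn n0; have p0 := prime_gt0 p_pr.
have mulpI : injective (muln p) by move=> a b /eqP; rewrite eqn_pmul2l // => /eqP.
apply: uniq_perm; first exact: divisors_uniq.
  rewrite cat_uniq divisors_uniq map_inj_uniq ?divisors_uniq // andbT.
  apply/hasPn => _ /mapP[e _ ->]; rewrite -dvdn_divisors //.
  by apply: contra pn; apply: dvdn_trans; apply: dvdn_mulr.
move=> d; rewrite mem_cat -!dvdn_divisors ?muln_gt0 ?p0 //.
apply/idP/orP => [d_pn|[d_n|/mapP[e]]]; last first.
- by rewrite -dvdn_divisors // => en ->; rewrite dvdn_pmul2l.
- by apply: dvdn_mull.
case: (boolP (p %| d)%N) => pd; [right|left].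
  apply/mapP; exists (d %/ p)%N; last by rewrite mulnC divnK.
  by rewrite -dvdn_divisors // dvdn_divLR // mulnC.
by rewrite -(Gauss_dvdr _ (_ : coprime d p)) // coprime_sym prime_coprime.
Qed.

Lemma Cyclotomic_neq0 n : 'Phi_n != 0.
Proof. exact: monic_neq0 (Cyclotomic_monic n). Qed.

Lemma Cyclotomic1 : 'Phi_1 = 'X - 1.
Proof. by rewrite -[RHS](@prod_Cyclotomic 1) // big_cons big_nil mulr1. Qed.

(** Strong induction: multiplied over all divisors of [n], both sides give ['X^(p * n) - 1], and the
    factors of the proper divisors cancel. *)
Lemma Cyclotomic_prime_mul (p n : nat) : prime p -> ~~ (p %| n)%N -> (0 < n)%N ->
  'Phi_(p * n) * 'Phi_n = 'Phi_n \Po 'X^p.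
Proof.
move=> p_pr; have p0 := prime_gt0 p_pr.
elim/ltn_ind: n => n IHn pn n0.
have neq0 : \prod_(d <- divisors n | d != n) ('Phi_d \Po 'X^p) != 0.
  rewrite prodf_seq_neq0; apply/allP => d _; apply/implyP => _.
  by rewrite comp_poly_eq0 ?Cyclotomic_neq0 // size_polyXn.
apply: (mulIf neq0).
have n_div : n \in divisors n by rewrite -dvdn_divisors.
rewrite -[RHS](bigD1_seq n n_div (divisors_uniq n)) /=.
transitivity (\prod_(d <- divisors n) ('Phi_(p * d) * 'Phi_d)).
  rewrite [RHS](bigD1_seq n n_div (divisors_uniq n)) /=; congr (_ * _).
  rewrite [RHS]big_seq_cond [LHS]big_seq_cond; apply: eq_bigr => d /andP[].
  rewrite -dvdn_divisors // => dn d_neq; rewrite IHn //.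
  - by rewrite ltn_neqAle d_neq dvdn_leq.
  - by apply: contra pn => /dvdn_trans; apply.
  - exact: dvdn_gt0 dn.
rewrite big_split /= mulrC -(big_map (muln p) xpredT (fun d => 'Phi_d)) -big_cat /=.
rewrite -(perm_big _ (perm_divisors_prime_mul p_pr pn n0)) /=.
rewrite prod_Cyclotomic ?muln_gt0 ?p0 //.
rewrite -(rmorph_prod (comp_poly 'X^p)) prod_Cyclotomic //=.
by rewrite comp_polyB comp_polyC comp_Xn_poly -exprM.
Qed.

Lemma Xn_sub1_neq0 n : (0 < n)%N -> 'X^n - 1 != 0 :> {poly int}.
Proof. by move=> n0; rewrite -size_poly_eq0 size_XnsubC. Qed.

Lemma Cyclotomic_prime r : prime r -> 'Phi_r * ('X - 1) = 'X^r - 1.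
Proof.
move=> r_pr; have := @Cyclotomic_prime_mul r 1 r_pr.
rewrite muln1 Cyclotomic1 dvdn1 => -> //; last by case: r r_pr => [|[]].
by rewrite comp_polyB comp_polyX comp_polyC.
Qed.

Lemma Cyclotomic_semiprime q r : prime q -> prime r -> q != r ->
  'Phi_(q * r) * ('X^q - 1) * ('X^r - 1) = ('X - 1) * ('X^(q * r) - 1).
Proof.
move=> q_pr r_pr qr; have r0 := prime_gt0 r_pr.
have Phi_r := Cyclotomic_prime r_pr.
have Phi_rq : ('Phi_r \Po 'X^q) * ('X^q - 1) = 'X^(q * r) - 1.
  have := congr1 (comp_poly 'X^q) Phi_r.
  by rewrite comp_polyM !comp_polyB comp_polyX comp_polyC comp_Xn_poly -exprM.
rewrite -Phi_r -Phi_rq -Cyclotomic_prime_mul // ?dvdn_prime2 //.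
ring.
Qed.

Definition lattice_poly (q r : nat) : {poly int} :=
  (\sum_(a < r) 'X^(a * q)) * (\sum_(b < q) 'X^(b * r)).

Lemma Cyclotomic_lattice_poly q r : prime q -> prime r -> q != r ->
  'Phi_(q * r) * ('X^(q * r) - 1) = ('X - 1) * lattice_poly q r.
Proof.
move=> q_pr r_pr qr; have qr0 : (0 < q * r)%N by rewrite muln_gt0 !prime_gt0.
have Xq : ('X^q - 1) * \sum_(a < r) 'X^(a * q) = 'X^(q * r) - 1 :> {poly int}.
  rewrite exprM [RHS]subrX1; congr (_ * _); apply: eq_bigr => a _.
  by rewrite -exprM mulnC.
have Xr : ('X^r - 1) * \sum_(b < q) 'X^(b * r) = 'X^(q * r) - 1 :> {poly int}.
  rewrite mulnC exprM [RHS]subrX1; congr (_ * _); apply: eq_bigr => a _.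
  by rewrite -exprM mulnC.
(* A second factor ['X^(q * r) - 1] allows each geometric sum to be traded for its denominator. *)
apply: (mulIf (Xn_sub1_neq0 qr0)).
rewrite -{1}Xq -{1}Xr /lattice_poly.
transitivity ('Phi_(q * r) * ('X^q - 1) * ('X^r - 1) *
   ((\sum_(a < r) 'X^(a * q)) * (\sum_(b < q) 'X^(b * r)))); first by ring.
by rewrite Cyclotomic_semiprime //; ring.
Qed.

Definition window_poly (q r : nat) : {poly int} :=
  (\sum_(i < q) 'X^i) * (1 - 'X^r).

Lemma Cyclotomic_window_poly p q r : prime p -> prime q -> prime r ->
  p != q -> p != r -> q != r ->
  'Phi_(p * (q * r)) * (1 - 'X^(q * r)) = ('Phi_(q * r) \Po 'X^p) * window_poly q r.
Proof.
move=> p_pr q_pr r_pr pq pr qr.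
have p_qr : ~~ (p %| q * r)%N by rewrite Euclid_dvdM // !dvdn_prime2 // negb_or pq.
have qr0 : (0 < q * r)%N by rewrite muln_gt0 !prime_gt0.
have X1 : ('X - 1 : {poly int}) != 0 by exact: (@Xn_sub1_neq0 1).
rewrite -Cyclotomic_prime_mul // /window_poly.
apply: (mulIf X1).
transitivity (- 'Phi_(p * (q * r)) * (('X - 1) * ('X^(q * r) - 1))); first by ring.
rewrite -Cyclotomic_semiprime //.
by rewrite (subrX1 'X q); ring.
Qed.

(** Dividing by [1 - 'X^d] repeats the coefficients of [P] with period [d], without overlap as
    [size P <= d]. *)
Lemma coef_periodic_quotient (d e K : nat) (c : nat -> int) (A P : {poly int}) :
  (0 < d)%N -> (size P <= d)%N ->
  A * (1 - 'X^d) = (\sum_(m < K) c m *: 'X^(e * m)) * P ->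
  forall n, A`_n = \sum_(m < K) c m * (if (n < e * m)%N then 0 else P`_((n - e * m) %% d)).
Proof.
move=> d0 Pd eqA; have step n : A`_n = (if (n < d)%N then 0 else A`_(n - d)) +
    \sum_(m < K) c m * (if (n < e * m)%N then 0 else P`_(n - e * m)).
  have := congr1 (fun B : {poly int} => B`_n) eqA.
  rewrite mulrBr mulr1 coefB coefMXn mulr_suml coef_sum => /eqP.
  rewrite subr_eq addrC => /eqP ->; congr (_ + _); apply: eq_bigr => m _.
  by rewrite -scalerAl coefZ coefXnM.
elim/ltn_ind => n IHn; rewrite step; case: ltnP => nd.
  rewrite add0r; apply: eq_bigr => m _; congr (_ * _).
  by case: ltnP => // mn; rewrite modn_small //; lia.
rewrite IHn; last by lia.
rewrite -big_split /=; apply: eq_bigr => m _; rewrite -mulrDr; congr (_ * _).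
case: (ltnP n (e * m)) => nm; first by rewrite ifT //; lia.
case: ltnP => ndm; first by rewrite add0r modn_small //; lia.
rewrite [X in _ + X]nth_default; last by apply: leq_trans Pd _; lia.
rewrite addr0.
have -> : (n - e * m = n - d - e * m + d)%N by lia.
by rewrite modnDr.
Qed.

(** * Windows of residues *)

Definition residue_window (d n : nat) (z : int) : int :=
  \sum_(0 <= i < n) ind (d%:Z %| z - i%:Z)%Z.

Lemma dvdz_small (d z : int) : - d < z < d -> (d %| z)%Z = (z == 0).
Proof.
move=> z_bnd; apply/idP/eqP => [/dvdzP[k zE]|->]; last exact: dvdz0.
have [k0|[k0|k0]] : k = 0 \/ 1 <= k \/ k <= -1 by lia.
- by rewrite zE k0 mul0r.
- by have : 1 * d <= k * d; [apply: ler_wpM2r; lia | lia].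
- by have : k * d <= -1 * d; [apply: ler_wpM2r; lia | lia].
Qed.

Lemma residue_window_small (d n : nat) (z : int) : (n%:Z - 1 - d%:Z < z < d%:Z) -> (n <= d)%N ->
  residue_window d n z = ind (0 <= z < n%:Z).
Proof.
move=> z_bnd nd; case: z z_bnd => k z_bnd.
  have -> : residue_window d n k = \sum_(0 <= i < n) ind (i == k) * 1.
    apply: eq_big_nat => i i_lt; rewrite mulr1 dvdz_small ?subr_eq0; last by lia.
    by congr ind; lia.
  by rewrite (sum_ind_eq n k (fun=> 1)) /ind; case: ltnP; lia.
rewrite /residue_window big_nat_cond big1 => [|i /andP[i_lt _]]; first by rewrite /ind; lia.
by rewrite dvdz_small /ind; lia.
Qed.

Lemma residue_window01 (d n : nat) (z : int) : (n <= d)%N -> 0 <= residue_window d n z <= 1.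
Proof.
move=> nd; rewrite sumr_ge0 //=; apply: sum_ind_le1 => i j ij di dj.
have : (d%:Z %| (z - i%:Z) - (z - j%:Z))%Z by apply: rpredB.
by rewrite dvdz_small; lia.
Qed.

(** A window of length [m + n] is cut after [m] or after [n] places. This will trade windows of
    length [q] for windows of length [s]. *)
Lemma residue_window_shift (d m n : nat) (z : int) :
  residue_window d m z - residue_window d m (z - n%:Z) =
  residue_window d n z - residue_window d n (z - m%:Z).
Proof.
have cat a b : residue_window d (a + b) z = residue_window d a z + residue_window d b (z - a%:Z).
  rewrite /residue_window (@big_cat_nat _ _ _ a) //= ?leq_addr //; congr (_ + _).
  rewrite -{1}(add0n a) big_addn addKn; apply: eq_bigr => i _.
  by congr (ind (_ %| _)%Z); lia.
have := cat m n; rewrite addnC cat; lia.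
Qed.

Lemma residue_window_mod (d n : nat) (z w : int) : (d%:Z %| z - w)%Z ->
  residue_window d n z = residue_window d n w.
Proof.
move=> zw; apply: eq_bigr => i _; congr ind.
have -> : z - i%:Z = (w - i%:Z) + (z - w) by ring.
by rewrite rpredDr.
Qed.

(** The coefficients of [window_poly], extended to all integers with period [q * r]. *)
Definition window (q r : nat) (z : int) : int :=
  residue_window (q * r)%N q z - residue_window (q * r)%N q (z - r%:Z).

Lemma window_mod (q r : nat) (z w : int) :
  ((q * r)%N%:Z %| z - w)%Z -> window q r z = window q r w.
Proof.
move=> zw; rewrite /window (residue_window_mod _ zw); congr (_ - _); apply: residue_window_mod.
by rewrite (_ : z - _ - _ = z - w) //; ring.
Qed.

Lemma window_bound (q r : nat) (z : int) : (0 < r)%N -> `|window q r z| <= 1.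
Proof.
move=> r0; have qr : (q <= q * r)%N by rewrite leq_pmulr.
by have := residue_window01 z qr; have := residue_window01 (z - r%:Z) qr; rewrite /window; lia.
Qed.

Lemma coef_sum_Xn (n j : nat) :
  (\sum_(i < n) 'X^i : {poly int})`_j = ind (j < n)%N.
Proof.
rewrite coef_sum -(big_mkord xpredT (fun i => ('X^i : {poly int})`_j)).
rewrite (eq_bigr (fun i => ind (i == j) * 1)); last first.
  by move=> i _; rewrite coefXn mulr1 eq_sym; case: eqP.
by rewrite (sum_ind_eq n j (fun=> 1)); case: ltnP.
Qed.

Lemma window_polyE (q r k : nat) : (1 < q)%N -> (1 < r)%N -> (k < q * r)%N ->
  (window_poly q r)`_k = window q r k%:Z.
Proof.
move=> q1 r1 k_lt; have qr : (q + r <= q * r)%N by nia.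
rewrite /window_poly mulrBr mulr1 coefB coefMXn !coef_sum_Xn /window.
rewrite !residue_window_small; try lia.
by case: (ltnP k r); rewrite /ind; lia.
Qed.

Lemma size_window_poly (q r : nat) : (1 < q)%N -> (1 < r)%N ->
  (size (window_poly q r) <= q * r)%N.
Proof.
move=> q1 r1; have qr : (q + r <= q * r)%N by nia.
apply: leq_trans (size_polyMleq _ _) _.
have s1 : (size (\sum_(i < q) 'X^i : {poly int})%R <= q)%N.
  by apply/leq_sizeP => j qj; rewrite coef_sum_Xn ltnNge qj.
have s2 : (size (1 - 'X^r : {poly int})%R <= r.+1)%N.
  by rewrite -opprB size_polyN size_XnsubC // ltnW.
apply: leq_trans (_ : (q + r.+1).-1 <= _)%N; last by rewrite addnS.
by rewrite -!subn1 leq_sub2r // leq_add.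
Qed.

Lemma lattice_polyE (q r m : nat) :
  (lattice_poly q r)`_m =
  \sum_(0 <= a < r) \sum_(0 <= b < q) ind (m == a * q + b * r)%N.
Proof.
rewrite /lattice_poly mulr_suml coef_sum big_mkord; apply: eq_bigr => a _.
rewrite mulr_sumr coef_sum big_mkord; apply: eq_bigr => b _.
by rewrite -exprD coefXn; case: eqP.
Qed.

Lemma sum_lattice_poly (q r M : nat) (f : nat -> int) :
  \sum_(0 <= m < M.+1) (lattice_poly q r)`_m * f m =
  \sum_(0 <= a < r) \sum_(0 <= b < q)
     ind (a * q + b * r <= M)%N * f (a * q + b * r)%N.
Proof.
under eq_bigr => m _ do rewrite lattice_polyE mulr_suml.
rewrite exchange_big /=; apply: eq_bigr => a _.
under eq_bigr => m _ do rewrite mulr_suml.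
rewrite exchange_big /=; apply: eq_bigr => b _.
by rewrite sum_ind_eq ltnS /ind; case: leqP; rewrite ?mul1r ?mul0r.
Qed.

(** * Lattice points as residues modulo [q * r] *)

Section Lattice.

Variables (q r s t u : nat).
Hypotheses (qr : coprime q r) (qE : q = (t * s + 2)%N) (rE : (2 * r = 1 + u * s * q)%N).

Let q0 : (0 < q)%N. Proof. lia. Qed.
Let r0 : (0 < r)%N. Proof. lia. Qed.
Let qEz : q%:Z = t%:Z * s%:Z + 2. Proof. lia. Qed.
Let rEz : u%:Z * s%:Z * q%:Z = 2 * r%:Z - 1. Proof. lia. Qed.

(** Modulo [r], the product [u * s * q] is -1. *)
Lemma dvd_r_residue (z : int) (a b : nat) :
  (r%:Z %| z - s%:Z * (a * q + b * r)%N%:Z)%Z = (r%:Z %| a%:Z + u%:Z * z)%Z.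
Proof.
rewrite PoszD !PoszM; apply/idP/idP => /dvdzP[k zE]; apply/dvdzP.
  exists (u%:Z * k + u%:Z * s%:Z * b%:Z + 2 * a%:Z).
  have -> : u%:Z * z = u%:Z * (z - s%:Z * (a%:Z * q%:Z + b%:Z * r%:Z))
     + a%:Z * (u%:Z * s%:Z * q%:Z) + u%:Z * s%:Z * b%:Z * r%:Z by ring.
  by rewrite zE rEz; ring.
exists (2 * z - s%:Z * q%:Z * k - s%:Z * b%:Z).
have -> : z - s%:Z * (a%:Z * q%:Z + b%:Z * r%:Z) =
   z * (1 + u%:Z * s%:Z * q%:Z) - s%:Z * q%:Z * (a%:Z + u%:Z * z) - s%:Z * b%:Z * r%:Z by ring.
by rewrite zE rEz; ring.
Qed.

(** Modulo [q], [t * s] is -2 and [2 * r] is 1, so [t * s * r] is -1. *)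
Lemma dvd_q_residue (z : int) (a b : nat) :
  (q%:Z %| z - s%:Z * (a * q + b * r)%N%:Z)%Z = (q%:Z %| b%:Z + t%:Z * z)%Z.
Proof.
rewrite PoszD !PoszM; apply/idP/idP => /dvdzP[k zE]; apply/dvdzP.
  exists (t%:Z * k + t%:Z * s%:Z * a%:Z + b%:Z * r%:Z - b%:Z * (u%:Z * s%:Z)).
  have -> : b%:Z + t%:Z * z = t%:Z * (z - s%:Z * (a%:Z * q%:Z + b%:Z * r%:Z))
     + t%:Z * s%:Z * a%:Z * q%:Z + b%:Z * (1 + (t%:Z * s%:Z) * r%:Z) by ring.
  rewrite zE (_ : t%:Z * s%:Z * r%:Z = q%:Z * r%:Z - 1 - u%:Z * s%:Z * q%:Z); first by ring.
  by rewrite rEz (_ : t%:Z * s%:Z = q%:Z - 2); [ring | rewrite qEz; ring].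
exists (z * r%:Z - z * u%:Z * s%:Z - s%:Z * a%:Z - s%:Z * r%:Z * k + 0).
have -> : z - s%:Z * (a%:Z * q%:Z + b%:Z * r%:Z) =
  z * (1 + (t%:Z * s%:Z) * r%:Z) - s%:Z * a%:Z * q%:Z - s%:Z * r%:Z * (b%:Z + t%:Z * z) by ring.
rewrite zE (_ : t%:Z * s%:Z * r%:Z = q%:Z * r%:Z - 1 - u%:Z * s%:Z * q%:Z); first by ring.
by rewrite rEz (_ : t%:Z * s%:Z = q%:Z - 2); [ring | rewrite qEz; ring].
Qed.

Lemma dvdz_residue (d a : nat) (z : int) : (a < d)%N ->
  (d%:Z %| a%:Z + z)%Z = (a == `|((- z) %% d%:Z)%Z|)%N.
Proof.
move=> ad; have d0 : (0 : int) < d%:Z by lia.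
have m0 := modz_ge0 (- z) (lt0r_neq0 d0).
transitivity (a%:Z == ((- z) %% d%:Z)%Z); last by lia.
by rewrite -[X in X == _](@modz_small a d%:Z) ?eqz_mod_dvd ?opprK; lia.
Qed.

Lemma lattice_residue (z : int) (a b : nat) : (a < r)%N -> (b < q)%N ->
  ((q * r)%N%:Z %| z - s%:Z * (a * q + b * r)%N%:Z)%Z =
  (a == `|((- u%:Z * z) %% r%:Z)%Z|)%N && (b == `|((- t%:Z * z) %% q%:Z)%Z|)%N.
Proof.
move=> ar bq; rewrite PoszM Gauss_dvdz; last by rewrite /coprimez /gcdz; exact: qr.
by rewrite dvd_r_residue dvd_q_residue !dvdz_residue // !mulNr andbC.
Qed.

(** By the Chinese remainder theorem exactly one lattice point satisfies the congruence. *)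
Lemma sum_lattice_residue (z : int) (F : nat -> int) :
  \sum_(0 <= a < r) \sum_(0 <= b < q)
    F (a * q + b * r)%N * ind ((q * r)%N%:Z %| z - s%:Z * (a * q + b * r)%N%:Z)%Z =
  F `|residue_value q%:Z r%:Z (- u%:Z * z) (- t%:Z * z)|%N.
Proof.
set A := `|((- u%:Z * z) %% r%:Z)%Z|%N; set B := `|((- t%:Z * z) %% q%:Z)%Z|%N.
have r_neq0 : r%:Z != 0 by lia.
have q_neq0 : q%:Z != 0 by lia.
have A_lt : (A < r)%N.
  by have := ltz_pmod (- u%:Z * z) (_ : 0 < r%:Z); have := modz_ge0 (- u%:Z * z) r_neq0; lia.
have B_lt : (B < q)%N.
  by have := ltz_pmod (- t%:Z * z) (_ : 0 < q%:Z); have := modz_ge0 (- t%:Z * z) q_neq0; lia.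
transitivity (\sum_(0 <= a < r) ind (a == A) *
   \sum_(0 <= b < q) ind (b == B) * F (a * q + b * r)%N).
  apply: eq_big_nat => a /andP[_ ar]; rewrite mulr_sumr; apply: eq_big_nat => b /andP[_ bq].
  by rewrite lattice_residue // -/A -/B; case: (a == A) (b == B) => -[]; rewrite /ind /= ?mulr1 ?mulr0 ?mul1r ?mul0r.
rewrite (sum_ind_eq r A) A_lt (sum_ind_eq q B (fun b => F (A * q + b * r)%N)) B_lt.
congr F; rewrite /residue_value /A /B.
have := modz_ge0 (- u%:Z * z) r_neq0; have := modz_ge0 (- t%:Z * z) q_neq0.
case: (_ %% q%:Z)%Z => // b _; by case: (_ %% r%:Z)%Z.
Qed.

(** The window consists of [s] congruences, the [i]-th selecting the point with coordinates
    [- u * (z - i)] and [- t * (z - i)]; hence the steps [u] and [t]. *)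
Lemma sum_window_lattice_count (M : nat) (z : int) :
  \sum_(0 <= a < r) \sum_(0 <= b < q) ind (a * q + b * r <= M)%N *
     residue_window (q * r)%N s (z - s%:Z * (a * q + b * r)%N%:Z) =
  lattice_count s t%:Z u%:Z q%:Z r%:Z M%:Z (- u%:Z * z) (- t%:Z * z).
Proof.
transitivity (\sum_(0 <= i < s) \sum_(0 <= a < r) \sum_(0 <= b < q)
  ind (a * q + b * r <= M)%N *
  ind ((q * r)%N%:Z %| (z - i%:Z) - s%:Z * (a * q + b * r)%N%:Z)%Z).
  rewrite [RHS]exchange_big; apply: eq_bigr => a _.
  rewrite [RHS]exchange_big; apply: eq_bigr => b _.
  rewrite mulr_sumr; apply: eq_bigr => i _.
  by congr (_ * ind (_ %| _)%Z); ring.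
apply: eq_bigr => i _; rewrite (sum_lattice_residue _ (fun m => ind (m <= M)%N)).
rewrite (_ : - u%:Z * (z - i%:Z) = - u%:Z * z + u%:Z * i%:Z); last by ring.
rewrite (_ : - t%:Z * (z - i%:Z) = - t%:Z * z + t%:Z * i%:Z); last by ring.
set L := residue_value _ _ _ _.
have : 0 <= L by rewrite addr_ge0 // mulr_ge0 // modz_ge0 //; lia.
by move=> L0; congr ind; lia.
Qed.

Lemma lattice_poly_coef01 (M : nat) : 0 <= (lattice_poly q r)`_M <= 1.
Proof.
rewrite lattice_polyE.
(* The inserted congruence holds whenever [M] is the exponent; it lets [sum_lattice_residue] reduce
   the sum to one indicator. *)
have -> : \sum_(0 <= a < r) \sum_(0 <= b < q) ind (M == a * q + b * r)%N =
  \sum_(0 <= a < r) \sum_(0 <= b < q) ind (M == a * q + b * r)%N *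
     ind ((q * r)%N%:Z %| s%:Z * M%:Z - s%:Z * (a * q + b * r)%N%:Z)%Z.
  apply: eq_bigr => a _; apply: eq_bigr => b _; case: eqP => [->|_].
    by rewrite subrr dvdz0.
  by rewrite mul0r.
by rewrite (sum_lattice_residue _ (fun m => ind (M == m)%N)); case: eqP.
Qed.

End Lattice.

(** * The coefficients as lattice counts *)

Section Coefficients.

Variables (p q r s t u k : nat).
Hypotheses (p_pr : prime p) (q_pr : prime q) (r_pr : prime r)
  (pq : p != q) (pr : p != r) (qr : q != r)
  (pE : p = (s + k * (q * r))%N) (qE : q = (t * s + 2)%N)
  (rE : (2 * r = 1 + u * s * q)%N).

Let p0 : (0 < p)%N. Proof. exact: prime_gt0. Qed.
Let q1 : (1 < q)%N. Proof. exact: prime_gt1. Qed.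
Let r1 : (1 < r)%N. Proof. exact: prime_gt1. Qed.
Let qr0 : (0 < q * r)%N. Proof. by rewrite muln_gt0 ?(ltnW q1) ?(ltnW r1). Qed.

Lemma Cyclotomic_coef_window (n : nat) :
  'Phi_(p * (q * r))`_n =
  \sum_(0 <= m < (n %/ p).+1) 'Phi_(q * r)`_m * window q r (n%:Z - s%:Z * m%:Z).
Proof.
set phi := 'Phi_(q * r); set M := (n %/ p)%N.
(* Padding [phi] by zeros lets the sum be cut at [M], beyond which its terms vanish. *)
pose K := (size phi + M.+1)%N.
have eqA : 'Phi_(p * (q * r)) * (1 - 'X^(q * r)) =
    (\sum_(m < K) phi`_m *: 'X^(p * m)) * window_poly q r.
  rewrite Cyclotomic_window_poly //; congr (_ * _); rewrite comp_polyE.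
  rewrite -(big_mkord xpredT (fun m => phi`_m *: ('X^p) ^+ m)).
  rewrite -(big_mkord xpredT (fun m => phi`_m *: 'X^(p * m))).
  rewrite [RHS](@big_cat_nat _ _ _ (size phi)) //= ?leq_addr //.
  rewrite [X in _ = _ + X]big_nat_cond [X in _ = _ + X]big1 ?addr0.
    by apply: eq_bigr => m _; rewrite exprM.
  by move=> m /andP[/andP[m_ge _] _]; rewrite nth_default ?scale0r.
rewrite (coef_periodic_quotient qr0 (size_window_poly q1 r1) eqA).
rewrite -(big_mkord xpredT (fun m => phi`_m *
  (if (n < p * m)%N then 0 else (window_poly q r)`_((n - p * m) %% (q * r))))).
rewrite (@big_cat_nat _ _ _ M.+1) //= ?leq_addl //.
rewrite [X in _ + X]big_nat_cond [X in _ + X]big1 ?addr0; last first.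
  move=> m /andP[/andP[m_ge _] _]; rewrite ifT ?mulr0 // mulnC.
  by rewrite -ltn_divLR.
apply: eq_big_nat => m /andP[_ m_le]; congr (_ * _).
have pm : (p * m <= n)%N by rewrite mulnC -leq_divRL.
rewrite ltnNge pm /= window_polyE ?ltn_mod //; apply: window_mod.
have modE := divn_eq (n - p * m) (q * r).
set b := ((n - p * m) %/ (q * r))%N in modE.
(* This quotient expresses that [p] is [s] modulo [q * r]. *)
apply/dvdzP; exists (- b%:Z - k%:Z * m%:Z).
have nE : n%:Z = p%:Z * m%:Z + b%:Z * (q * r)%N%:Z + ((n - p * m) %% (q * r))%N%:Z.
  by move: modE; move: ((n - p * m) %% (q * r))%N b => c b; lia.
have pEz : p%:Z = s%:Z + k%:Z * (q * r)%N%:Z by rewrite pE PoszD PoszM.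
by rewrite [X in _ - (X - _)]nE pEz; ring.
Qed.

(** Below degree [q * r] the factor ['X^(q * r) - 1] acts as -1. *)
Lemma Cyclotomic_semiprime_coef (m : nat) : (m < q * r)%N ->
  'Phi_(q * r)`_m =
  (lattice_poly q r)`_m - (if m == 0%N then 0 else (lattice_poly q r)`_m.-1).
Proof.
move=> m_lt.
have := congr1 (fun A : {poly int} => A`_m) (Cyclotomic_lattice_poly q_pr r_pr qr).
rewrite mulrBr mulr1 mulrBl mul1r !coefB coefMXn m_lt coefXM sub0r.
by move=> eq_m; rewrite -[LHS]opprK eq_m opprB.
Qed.

Lemma sum_Cyclotomic_semiprime_coef (M : nat) (c : nat -> int) : (M < q * r)%N ->
  \sum_(0 <= m < M.+1) 'Phi_(q * r)`_m * c m =
  \sum_(0 <= m < M.+1) (lattice_poly q r)`_m * (c m - c m.+1)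
  + (lattice_poly q r)`_M * c M.+1.
Proof.
elim: M => [|M IHM] M_lt.
  by rewrite !big_nat1 Cyclotomic_semiprime_coef //= subr0; ring.
rewrite big_nat_recr //= IHM; last exact: ltnW.
by rewrite [in RHS]big_nat_recr //= Cyclotomic_semiprime_coef //=; ring.
Qed.

(** Exchanging the lengths [q] and [s] twice produces the windows that [lattice_count] counts. *)
Lemma window_diff (z : int) :
  window q r z - window q r (z - s%:Z) =
  residue_window (q * r)%N s z - residue_window (q * r)%N s (z - q%:Z)
  - residue_window (q * r)%N s (z - r%:Z)
  + residue_window (q * r)%N s (z - q%:Z - r%:Z).
Proof.
have e1 := residue_window_shift (q * r)%N q s z.
have e2 := residue_window_shift (q * r)%N q s (z - r%:Z).
rewrite /window.
have -> : z - s%:Z - r%:Z = z - r%:Z - s%:Z by ring.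
have -> : z - q%:Z - r%:Z = z - r%:Z - q%:Z by ring.
move: e1 e2.
move: (residue_window _ _ (z - s%:Z)) (residue_window _ _ (z - q%:Z)) => a b.
lia.
Qed.

Let T (M : nat) (z : int) : int :=
  lattice_count s t%:Z u%:Z q%:Z r%:Z M%:Z (- u%:Z * z) (- t%:Z * z).

Lemma Cyclotomic_coef_lattice (n : nat) : (n %/ p < q * r)%N ->
  'Phi_(p * (q * r))`_n =
  T (n %/ p) n%:Z - T (n %/ p) (n%:Z - q%:Z) - T (n %/ p) (n%:Z - r%:Z)
  + T (n %/ p) (n%:Z - q%:Z - r%:Z)
  + (lattice_poly q r)`_(n %/ p) * window q r (n%:Z - s%:Z * (n %/ p).+1%:Z).
Proof.
move=> M_lt; rewrite Cyclotomic_coef_window sum_Cyclotomic_semiprime_coef //.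
congr (_ + _); set M := (n %/ p)%N.
pose W (z : int) (m : nat) := residue_window (q * r)%N s (z - s%:Z * m%:Z).
under eq_bigr => m _.
  rewrite (_ : _ - window _ _ _ = W n%:Z m - W (n%:Z - q%:Z) m - W (n%:Z - r%:Z) m
                                  + W (n%:Z - q%:Z - r%:Z) m); last first.
    rewrite (_ : n%:Z - s%:Z * m.+1%:Z = n%:Z - s%:Z * m%:Z - s%:Z); last by lia.
    by rewrite window_diff /W; congr (_ - residue_window _ _ _ - residue_window _ _ _
        + residue_window _ _ _); ring.
  over.
rewrite sum_lattice_poly.
have TW z : T M z = \sum_(0 <= a < r) \sum_(0 <= b < q)
    ind (a * q + b * r <= M)%N * W z (a * q + b * r)%N.
  have cop : coprime q r by rewrite prime_coprime // dvdn_prime2.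
  by rewrite /T -sum_window_lattice_count.
rewrite !TW -!sumrB -big_split /=; apply: eq_bigr => a _.
rewrite -!sumrB -big_split /=; apply: eq_bigr => b _.
ring.
Qed.

End Coefficients.

(** * Height of the polynomial *)

Section Height.

Variables (h p q r s t u k : nat).
Hypotheses (p_pr : prime p) (q_pr : prime q) (r_pr : prime r)
  (pq : p != q) (pr : p != r) (qr : q != r) (q_odd : odd q)
  (h0 : (0 < h)%N) (sE : s = (2 * h - 1)%N) (t0 : (0 < t)%N) (u0 : (0 < u)%N)
  (pE : p = (s + k * (q * r))%N) (qE : q = (t * s + 2)%N)
  (rE : (2 * r = 1 + u * s * q)%N).

Let q1 : (1 < q)%N. Proof. exact: prime_gt1. Qed.
Let r1 : (1 < r)%N. Proof. exact: prime_gt1. Qed.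
Let tz0 : 0 < t%:Z. Proof. by rewrite ltz_nat. Qed.
Let uz0 : 0 < u%:Z. Proof. by rewrite ltz_nat. Qed.
Let qEz : q%:Z = t%:Z * s%:Z + 2. Proof. lia. Qed.
Let rEz : 2 * r%:Z = 1 + u%:Z * s%:Z * q%:Z. Proof. lia. Qed.
Let sEz : s%:Z = 2 * h%:Z - 1. Proof. lia. Qed.

Local Notation coef := ('Phi_(p * (q * r))).
Local Notation T := (lattice_count s t%:Z u%:Z q%:Z r%:Z).

(** Hence replacing [n] by [n - r] shifts the coordinate [- t * n] by [t * h + 1]. The proof
    doubles, [q] being odd, to use [2 * r = 1 + u * s * q]. *)
Let q_dvd : (q%:Z %| t%:Z * r%:Z - (t%:Z * h%:Z + 1))%Z.
Proof.
have q2 : coprime q 2 by rewrite coprimen2.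
rewrite -(@Gauss_dvdzr _ 2); last by rewrite /coprimez /gcdz; exact: q2.
apply/dvdzP; exists (t%:Z * u%:Z * s%:Z - 1).
have -> : 2 * (t%:Z * r%:Z - (t%:Z * h%:Z + 1)) =
   t%:Z * (2 * r%:Z) - t%:Z * (2 * h%:Z - 1) - t%:Z - 2 by ring.
by rewrite rEz -sEz qEz; ring.
Qed.

Lemma Cyclotomic_coef_lattice_mod (n : nat) (x x' y y' : int) :
  (n %/ p < q * r)%N ->
  (x = - u%:Z * n%:Z %[mod r%:Z])%Z -> (x' = x + u%:Z * q%:Z %[mod r%:Z])%Z ->
  (y = - t%:Z * n%:Z %[mod q%:Z])%Z ->
  (y' = y + t%:Z * h%:Z + 1 %[mod q%:Z])%Z ->
  let M := (n %/ p)%N in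
  coef`_n = T M%:Z x y - T M%:Z x' y - T M%:Z x y' + T M%:Z x' y'
   + (lattice_poly q r)`_M * window q r (n%:Z - s%:Z * M.+1%:Z).
Proof.
move=> M_lt xn xx' yn yy' M; rewrite (Cyclotomic_coef_lattice p_pr q_pr r_pr pq pr qr pE qE rE) // -/M.
have x_r : (- u%:Z * (n%:Z - r%:Z) = x %[mod r%:Z])%Z.
  by rewrite xn (_ : _ * (_ - _) = u%:Z * r%:Z + - u%:Z * n%:Z) ?modzMDl //; ring.
have x_q : (- u%:Z * (n%:Z - q%:Z) = x' %[mod r%:Z])%Z.
  by rewrite xx' -modzDml xn modzDml; congr (_ %% _)%Z; ring.
have x_qr : (- u%:Z * (n%:Z - q%:Z - r%:Z) = x' %[mod r%:Z])%Z.
  rewrite -x_q (_ : _ * (_ - _) = u%:Z * r%:Z + - u%:Z * (n%:Z - q%:Z)); last by ring.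
  by rewrite modzMDl.
have y_q : (- t%:Z * (n%:Z - q%:Z) = y %[mod q%:Z])%Z.
  by rewrite yn (_ : _ * (_ - _) = t%:Z * q%:Z + - t%:Z * n%:Z) ?modzMDl //; ring.
have y_r : (- t%:Z * (n%:Z - r%:Z) = y' %[mod q%:Z])%Z.
  rewrite yy' -addrA -modzDml yn modzDml; apply/eqP; rewrite eqz_mod_dvd.
  rewrite (_ : _ - _ = t%:Z * r%:Z - (t%:Z * h%:Z + 1)) //; ring.
have y_qr : (- t%:Z * (n%:Z - q%:Z - r%:Z) = y' %[mod q%:Z])%Z.
  rewrite (_ : _ * _ = t%:Z * q%:Z + - t%:Z * (n%:Z - r%:Z)); last by ring.
  by rewrite modzMDl.
congr (_ - _ - _ + _ + _); apply: eq_lattice_count => //; exact: esym.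
Qed.

Lemma Cyclotomic_coef_bound (n : nat) : (n %/ p < q * r)%N ->
  `|coef`_n| <= (h + 1)%N%:Z.
Proof.
move=> M_lt.
rewrite (@Cyclotomic_coef_lattice_mod n (- u%:Z * n%:Z) (- u%:Z * n%:Z + u%:Z * q%:Z)
  (- t%:Z * n%:Z) (- t%:Z * n%:Z + t%:Z * h%:Z + 1)) //.
set D := _ + T _ _ _; set b := _ * window _ _ _.
have D_le : `|D| <= h%:Z.
  apply: lattice_count_diff_bound => //.
  by rewrite -PoszM ltz_nat mulnC.
have b_le : `|b| <= 1.
  have w := window_bound q (n%:Z - s%:Z * (n %/ p).+1%:Z) (ltnW r1).
  rewrite /b normrM; apply: le_trans (_ : 1 * 1 <= _) => //.
  apply: ler_pM => //.
  have cop : coprime q r by rewrite prime_coprime // dvdn_prime2.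
  by have /andP[g0 g1] := lattice_poly_coef01 cop qE rE (n %/ p); rewrite ger0_norm.
by apply: le_trans (ler_normD _ _) _; rewrite PoszD lerD.
Qed.

(** Neither [- e] nor [- e - r] lies in [0, ..., q - 1] modulo [q * r]. This serves to remove the
    boundary term. *)
Lemma window_neg (e : nat) : (2 < r)%N -> (0 < e <= q - 2)%N -> window q r (- e%:Z) = 0.
Proof.
move=> r3 e_bnd.
have qr3 : (q * 3 <= q * r)%N by rewrite leq_mul.
have rq3 : (r * 3 <= q * r)%N by rewrite mulnC leq_mul //; case: q q1 q_odd => [|[|[]]].
rewrite /window; move: (q * r)%N qr3 rq3 => d dq dr.
rewrite !residue_window_small; try lia.
by rewrite /ind; lia.
Qed.

(** The boundary window is taken at [c - s] modulo [q * r], and [0 < s - c <= s <= q - 2]. *)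
Lemma Cyclotomic_coef_no_boundary (n M c : nat) (x x' y y' : int) :
  (2 < r)%N -> n = (M * p + c)%N -> (c < s)%N -> (M < q * r)%N ->
  (x = - u%:Z * (s * M + c)%N%:Z %[mod r%:Z])%Z -> (x' = x + u%:Z * q%:Z %[mod r%:Z])%Z ->
  (y = - t%:Z * (s * M + c)%N%:Z %[mod q%:Z])%Z ->
  (y' = y + t%:Z * h%:Z + 1 %[mod q%:Z])%Z ->
  coef`_n = T M%:Z x y - T M%:Z x' y - T M%:Z x y' + T M%:Z x' y'.
Proof.
move=> r3 nE cs M_lt xn xx' yn yy'.
have sp : (s <= p)%N by rewrite pE leq_addr.
have nM : (n %/ p)%N = M.
  by rewrite nE divnMDl ?prime_gt0 // divn_small ?addn0 // (leq_trans cs).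
have nz : n%:Z = (s * M + c)%N%:Z + k%:Z * M%:Z * q%:Z * r%:Z.
  by rewrite nE pE; lia.
rewrite (@Cyclotomic_coef_lattice_mod n x x' y y') ?nM //.
- rewrite (_ : window _ _ _ = 0) ?mulr0 ?addr0 //.
  rewrite (@window_mod _ _ _ (c%:Z - s%:Z)); last first.
    by apply/dvdzP; exists (k%:Z * M%:Z); rewrite nz; lia.
  have -> : c%:Z - s%:Z = - (s - c)%N%:Z by rewrite -subzn ?opprB // ltnW.
  apply: window_neg => //; rewrite subn_gt0 cs /= (leq_trans (leq_subr _ _)) //.
  by rewrite qE addnK leq_pmull.
- rewrite xn nz (_ : _ * (_ + _) = (- u%:Z * k%:Z * M%:Z * q%:Z) * r%:Z + - u%:Z * (s * M + c)%N%:Z); last by ring.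
  by rewrite modzMDl.
- rewrite yn nz (_ : _ * (_ + _) = (- t%:Z * k%:Z * M%:Z * r%:Z) * q%:Z + - t%:Z * (s * M + c)%N%:Z); last by ring.
  by rewrite modzMDl.
Qed.

End Height.

(** * Explicit coefficients of absolute value [h] *)

Section Extremal.

Variables (h p q r s t u k : nat).
Hypotheses (p_pr : prime p) (q_pr : prime q) (r_pr : prime r)
  (pq : p != q) (pr : p != r) (qr : q != r) (q_odd : odd q)
  (h1 : (1 < h)%N) (sE : s = (2 * h - 1)%N) (t0 : (0 < t)%N) (u0 : (0 < u)%N)
  (pE : p = (s + k * (q * r))%N) (qE : q = (t * s + 2)%N)
  (rE : (2 * r = 1 + u * s * q)%N).

Let h0 : (0 < h)%N. Proof. exact: ltnW. Qed.
Let s3 : (3 <= s)%N. Proof. lia. Qed.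
Let tz0 : 0 < t%:Z. Proof. by rewrite ltz_nat. Qed.
Let uz0 : 0 < u%:Z. Proof. by rewrite ltz_nat. Qed.
Let qEz : q%:Z = t%:Z * s%:Z + 2. Proof. lia. Qed.
Let rEz : 2 * r%:Z = 1 + u%:Z * s%:Z * q%:Z. Proof. lia. Qed.
Let sEz : s%:Z = 2 * h%:Z - 1. Proof. lia. Qed.
Let ts : (s <= t * s)%N. Proof. by rewrite leq_pmull. Qed.
Let uq : (q <= u * q)%N. Proof. by rewrite leq_pmull. Qed.
Let uq_lt : (u * q < r)%N.
Proof.
by have : (3 * (u * q) <= s * (u * q))%N; [rewrite leq_mul2r s3 orbT | lia].
Qed.
Let r3 : (2 < r)%N. Proof. lia. Qed.
Let d := (u * q + t * r)%N.
Let dE : d%:Z = u%:Z * q%:Z + t%:Z * r%:Z. Proof. by rewrite PoszD !PoszM. Qed.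
Let sd : s%:Z * d%:Z = r%:Z * q%:Z - 1.
Proof.
rewrite dE (_ : _ * _ = u%:Z * s%:Z * q%:Z + (t%:Z * s%:Z) * r%:Z); last by ring.
have -> : u%:Z * s%:Z * q%:Z = 2 * r%:Z - 1 by rewrite rEz; ring.
by rewrite [in RHS]qEz; ring.
Qed.

Lemma Cyclotomic_coef_extremal : exists n, `|'Phi_(p * (q * r))`_n| = h%:Z.
Proof.
case: (ltnP 2 h) => h3; last first.
  have h2 : h = 2%N by lia.
  have s_eq : s = 3%N by lia.
  have M_lt : (d < q * r)%N.
    by move: sd; rewrite s_eq -PoszM; lia.
  (* As [s * d + 2 = r * q + 1], the coordinates are [- u] modulo [r] and [- t] modulo [q]. *)
  exists (d * p + 2)%N.
  have zE : (s * d + 2)%N%:Z = r%:Z * q%:Z + 1 by rewrite PoszD PoszM sd; ring.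
  rewrite (Cyclotomic_coef_no_boundary p_pr q_pr r_pr pq pr qr q_odd h0 sE t0 u0 pE qE rE
     r3 (erefl _) _ M_lt (x := r%:Z - u%:Z) (x' := u%:Z * (q%:Z - 1))
     (y := q%:Z - t%:Z) (y' := t%:Z + 1)).
  - by rewrite dE (lattice_count_diff_extremal2 h1 sE) // h2.
  - by rewrite s_eq.
  - rewrite zE (_ : _ * _ = (- u%:Z * q%:Z) * r%:Z - u%:Z); last by ring.
    by rewrite modzMDl modzDl.
  - rewrite [in RHS](_ : _ + _ = r%:Z + u%:Z * (q%:Z - 1)); last by ring.
    by rewrite modzDl.
  - rewrite zE (_ : _ * _ = (- t%:Z * r%:Z) * q%:Z - t%:Z); last by ring.
    by rewrite modzMDl modzDl.
  - rewrite h2 (_ : _ + _ + _ = q%:Z + (t%:Z + 1)); last by ring.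
    by rewrite modzDl.
pose M := ((h - 1) * d - u * q * h)%N.
have tr0 : (r <= t * r)%N by rewrite leq_pmull.
(* This form shows that the truncated subtraction in [M] is exact. *)
have ME' : (h - 1)%N%:Z * d%:Z - u%:Z * q%:Z * h%:Z = (h%:Z - 1) * (t%:Z * r%:Z) - u%:Z * q%:Z.
  by rewrite dE -subzn //; ring.
have htr : 1 * (t%:Z * r%:Z) <= (h%:Z - 1) * (t%:Z * r%:Z) by apply: ler_wpM2r; lia.
have ME : M%:Z = (h%:Z - 1) * d%:Z - u%:Z * q%:Z * h%:Z by rewrite /M; lia.
have M_lt : (M < q * r)%N by lia.
(* The remainder [h - 1] cancels the [- (h - 1)] in [(h - 1) * (s * d)]; then [s * M + (h - 1)] is 0
   modulo [q] and [h] modulo [r]. *)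
exists (M * p + (h - 1))%N.
have zE : (s * M + (h - 1))%N%:Z = (h%:Z - 1) * (r%:Z * q%:Z) - u%:Z * s%:Z * q%:Z * h%:Z.
  rewrite PoszD PoszM ME -subzn //.
  rewrite (_ : _ * (_ - _) = (h%:Z - 1) * (s%:Z * d%:Z) - u%:Z * s%:Z * q%:Z * h%:Z); last by ring.
  by rewrite sd; ring.
rewrite (Cyclotomic_coef_no_boundary p_pr q_pr r_pr pq pr qr q_odd h0 sE t0 u0 pE qE rE
     r3 (erefl _) _ M_lt (x := r%:Z - u%:Z * h%:Z) (x' := u%:Z * (q%:Z - h%:Z))
     (y := 0) (y' := t%:Z * h%:Z + 1)).
- by rewrite ME dE (lattice_count_diff_extremal h1 sE) // normrN.
- lia.
- rewrite zE (_ : u%:Z * s%:Z * q%:Z = 2 * r%:Z - 1); last by rewrite rEz; ring.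
  rewrite (_ : _ * _ = (- u%:Z * ((h%:Z - 1) * q%:Z - 2 * h%:Z)) * r%:Z - u%:Z * h%:Z); last by ring.
  by rewrite modzMDl modzDl.
- rewrite [in RHS](_ : _ + _ = r%:Z + u%:Z * (q%:Z - h%:Z)); last by ring.
  by rewrite modzDl.
- rewrite zE (_ : _ * _ = (- t%:Z * ((h%:Z - 1) * r%:Z - u%:Z * s%:Z * h%:Z)) * q%:Z + 0); last by ring.
  by rewrite modzMDl.
- by rewrite add0r.
Qed.

End Extremal.

(** * From the congruences to the height *)

Local Open Scope nat_scope.

Theorem theorem1 (h p' p q r : nat) (h_gt0 : 0 < h) (def_p' : p' = 2 * h - 1)
    (p_prime : prime p) (q_prime : prime q) (r_prime : prime r)
    (p_odd : odd p) (q_odd : odd q) (r_odd : odd r)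
    (q_mod : q = 2 %[mod p'])
    (r_mod : r = (p' * q + 1) %/ 2 %[mod p' * q])
    (p_mod : p = p' %[mod q * r]) :
  cyclotomic_height (p * q * r) = h \/ cyclotomic_height (p * q * r) = h + 1.
Proof.
have q2 : 2 < q by case: q q_prime q_odd {q_mod r_mod p_mod} => [|[|[]]].
have r2 : 2 < r by case: r r_prime r_odd {r_mod p_mod} => [|[|[]]].
have p'_odd : odd p'.
  have -> : p' = (h.-1 * 2).+1 by clear -h_gt0 def_p'; lia.
  by rewrite oddS oddM andbF.
have p'_gt0 : 0 < p' by rewrite odd_gt0.
have [t tE] : exists t, q - 2 = t * p'.
  by apply/dvdnP; rewrite -eqn_mod_dvd ?(ltnW q2) //; apply/eqP.
have qE : q = t * p' + 2 by rewrite -tE subnK // ltnW.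
have t0 : 0 < t by case: t tE {qE} => // /eqP; rewrite subn_eq0 leqNgt q2.
have p'_lt : p' < q.
  by rewrite qE -addn1 leq_add // leq_pmull.
have [u uE] : exists u, 2 * r - 1 = u * (p' * q).
  apply/dvdnP; rewrite -eqn_mod_dvd ?muln_gt0 ?prime_gt0 //.
  (* As [p' * q] is odd the halving is exact, so [2 * r] is 1 modulo [p' * q]. *)
  rewrite -modnMmr r_mod modnMmr mulnC divnK; last by rewrite dvdn2 oddD oddM p'_odd q_odd.
  by rewrite addnC modnDr.
have rE : 2 * r = 1 + u * p' * q.
  by move: uE r2; rewrite mulnA; clear; lia.
have u0 : 0 < u.
  by case: u uE {rE} => //; move: r2; clear; lia.
have qr_gt : p' < q * r by apply: leq_trans p'_lt _; rewrite leq_pmulr // prime_gt0.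
have pE : p = p' + (p %/ (q * r)) * (q * r).
  by rewrite {1}(divn_eq p (q * r)) p_mod (modn_small qr_gt) addnC.
clear q_mod r_mod p_mod tE uE.
have qr : q != r.
  apply/eqP => qr; have : q %| 1 + u * p' * q by rewrite -rE -qr dvdn_mull.
  by rewrite dvdn_addl ?dvdn_mull // dvdn1 => /eqP q_eq; rewrite q_eq in q2.
have pq : p != q.
  apply/eqP => pq; have : q %| p' + (p %/ (q * r)) * (q * r) by rewrite -pE pq.
  rewrite dvdn_addl; last by rewrite dvdn_mull // dvdn_mulr.
  by move=> /(dvdn_leq p'_gt0); rewrite leqNgt p'_lt.
have pr : p != r.
  apply/eqP => pr; have : r %| p' + (p %/ (q * r)) * (q * r) by rewrite -pE pr.
  rewrite dvdn_addl; last by rewrite dvdn_mull // dvdn_mull.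
  move=> rp'; have : r %| 1 + u * p' * q by rewrite -rE dvdn_mull.
  rewrite dvdn_addl; last by rewrite dvdn_mulr // dvdn_mull.
  by rewrite dvdn1 => /eqP r_eq; rewrite r_eq in r2.
move: (p %/ (q * r)) pE => k pE.
have n0 : 0 < p * (q * r) by rewrite !muln_gt0 !prime_gt0.
have cop_p : coprime p (q * r).
  by rewrite prime_coprime // Euclid_dvdM // !dvdn_prime2 // negb_or pq.
have cop_q : coprime q r by rewrite prime_coprime // dvdn_prime2.
have totE : totient (p * (q * r)) = p.-1 * (q.-1 * r.-1).
  by rewrite !totient_coprime // !totient_prime.
(* Ensures [m %/ p < q * r] for every index [m] up to the degree. *)
have tot_lt : totient (p * (q * r)) < p * (q * r).
  rewrite totE; apply: leq_ltn_trans (_ : p.-1 * (q * r) < _).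
    by rewrite leq_mul // leq_mul // leq_pred.
  by rewrite ltn_pmul2r ?muln_gt0 ?prime_gt0 // ltn_predL prime_gt0.
rewrite /cyclotomic_height -mulnA.
set H := \max_(m < _) _.
have H_le : H <= h + 1.
  apply/bigmax_leqP => m _.
  have m_lt : m %/ p < q * r.
    rewrite ltn_divLR ?prime_gt0 // (mulnC (q * r)).
    by apply: leq_ltn_trans tot_lt; rewrite -ltnS.
  have := Cyclotomic_coef_bound p_prime q_prime r_prime pq pr qr q_odd h_gt0
    def_p' t0 u0 pE qE rE m_lt.
  by rewrite -abszE lez_nat.
have H_ge n : ('Phi_(p * (q * r))`_n != 0)%R -> `|('Phi_(p * (q * r))`_n)%R| <= H.
  move=> cn; have n_lt : n < (totient (p * (q * r))).+1.
    by rewrite -size_Cyclotomic ltnNge; apply: contra cn => n_ge; rewrite nth_default.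
  exact: (@leq_bigmax _ (fun m : 'I_ _ => `|('Phi_(p * (q * r))`_m)%R|) (Ordinal n_lt)).
suff : h <= H by lia.
case: (ltnP 1 h) => h1.
  have [n nE] := Cyclotomic_coef_extremal p_prime q_prime r_prime pq pr qr q_odd h1
    def_p' t0 u0 pE qE rE.
  have := H_ge n; rewrite -normr_eq0 nE; move: nE; rewrite -abszE => -[->].
  by apply; lia.
(* Here the leading coefficient suffices. *)
have -> : h = 1 by lia.
have lead1 : ('Phi_(p * (q * r))`_(totient (p * (q * r))) = 1)%R.
  by have /monicP := Cyclotomic_monic (p * (q * r)); rewrite lead_coefE size_Cyclotomic.
by have := H_ge (totient (p * (q * r))); rewrite lead1; apply.
Qed.
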